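(* Let $\pi$ be an irreducible generic representation of $G$, let $\psi_E$ be a nontrivial additive character of $E$, and let $n\ge0$. Suppose that a Whittaker function $W\in\mathcal{W}(\pi,\psi_E)$ is fixed by $K_{n,H}$ (under right translation). Then $$Z(s,W,\Phi_n)=Z(s,W)\,L_E(s,1).$$
   Context: Fields: $F$ is a non-archimedean local field of characteristic zero and odd residual characteristic, with $\mathfrak{o}_F$, $\mathfrak{p}_F=\varpi\mathfrak{o}_F$, $q=\#(\mathfrak{o}_F/\mathfrak{p}_F)$. $E=F[\sqrt\epsilon]$ is the unramified quadratic extension, $\epsilon\in\mathfrak{o}_F^\times$ a non-square unit; bar is the nontrivial element of $\mathrm{Gal}(E/F)$; $\varpi$ is a uniformizer of $E$, $|\varpi|_E=q^{-2}$. Groups: $G=\{g\in\mathrm{GL}_3(E): {}^t\overline{g}Jg=J\}$ with $J$ the antidiagonal matrix with all antidiagonal entries $1$. $U$ is the subgroup of $u(x,y)=\begin{pmatrix}1&x&y\\0&1&-\overline{x}\\0&0&1\end{pmatrix}$, $x,y\in E$, $y+\overline y+x\overline x=0$. $H$ is the subgroup of $\begin{pmatrix}a&0&b\\0&1&0\\c&0&d\end{pmatrix}\in G$, identified with $\mathrm{U}(1,1)(E/F)$ via $\begin{pmatrix}a&b\\c&d\end{pmatrix}$; $U_H=U\cap H$. For $a\in E^\times$, $t(a)=\mathrm{diag}(a,1,\overline{a}^{-1})\in H$ (identified with $\mathrm{diag}(a,\overline a^{-1})$), $d(a)=\mathrm{diag}(a,1)$ ($2\times 2$). Every $h\in H$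 can be written $h=t(b)d(\sqrt\epsilon)h_1d(\sqrt\epsilon^{-1})$ with $b\in E^\times$, $h_1\in\mathrm{SL}_2(F)$. $K_n=\begin{pmatrix}\mathfrak{o}_E&\mathfrak{o}_E&\mathfrak{p}_E^{-n}\\\mathfrak{p}_E^n&1+\mathfrak{p}_E^n&\mathfrak{o}_E\\\mathfrak{p}_E^n&\mathfrak{p}_E^n&\mathfrak{o}_E\end{pmatrix}\cap G$ and $K_{n,H}=K_n\cap H$, identified with $\begin{pmatrix}\mathfrak{o}_E&\mathfrak{p}_E^{-n}\\\mathfrak{p}_E^n&\mathfrak{o}_E\end{pmatrix}\cap\mathrm{U}(1,1)(E/F)$. Whittaker functions: $\psi_E(u(x,y))=\psi_E(x)$ on $U$. $(\pi,V)$ is generic if $\mathrm{Hom}_U(\pi,\psi_E)\ne\{0\}$; for irreducible generic $\pi$ this space is one-dimensional, and for a nonzero $l$ in it, $W_v(g)=l(\pi(g)v)$, $\mathcal{W}(\pi,\psi_E)=\{W_v:v\in V\}$. Zeta integrals: for a locally constant compactly supported $\Phi$ on $F^2$ and $g\in\mathrm{GL}_2(F)$, $(g\Phi)(x,y)=\Phi((x,y)g)$, $z(s,g,\Phi)=\int_{F^\times}(g\Phi)(0,r)|r|_E^s\,d^\times r$ with $\mathrm{vol}(\mathfrak{o}_F^\times)=1$; $f(s,h,\Phi)=|b|_E^sz(s,h_1,\Phi)$ for $h=t(b)d(\sqrt\epsilon)h_1d(\sqrt\epsilon^{-1})$ (well defined). $Z(s,W,\Phi)=\int_{U_H\backslash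 H}W(h)f(s,h,\Phi)\,dh$ and $Z(s,W)=\int_{E^\times}W(t(a))|a|_E^{s-1}\,d^\times a$. Haar measures on $E^\times$ and $K_{n,H}$ give $\mathfrak{o}_E^\times$ and $K_{n,H}$ volume one, and the measure on $U_H\backslash H$ is the one given, via the Iwasawa decomposition $H=U_H\{t(a)\}K_{n,H}$, by $\int_{E^\times}\int_{K_{n,H}}(\cdot)(t(a)k)\,|a|_E^{-1}\,dk\,d^\times a$. Both integrals converge absolutely for $\mathrm{Re}(s)$ large to functions in $\mathbf{C}(q^{-2s})$. $\Phi_n$ is the characteristic function of $\mathfrak{p}_F^n\oplus\mathfrak{o}_F$, and $L_E(s,1)=1/(1-q^{-2s})$. *)

(* Defs.v *)
From HB Require Import structures.
From mathcomp Require Import all_boot all_order all_algebra all_field.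
From mathcomp Require Import all_classical all_reals all_analysis.
From mathcomp Require Import complex.

Set Implicit Arguments.
Unset Strict Implicit.
Unset Printing Implicit Defensive.
Import Order.TTheory GRing.Theory Num.Theory.

Local Open Scope classical_set_scope.
Local Open Scope card_scope.
Local Open Scope complex_scope.
Local Open Scope ring_scope.

Local Notation Re := complex.Re.
Local Notation Im := complex.Im.

Definition matrix_of_rows (A : zmodType) (m n : nat) (rows : seq (seq A)) :
  'M[A]_(m, n) := \matrix_(i, j) nth 0 (nth [::] rows i) j.

Record nonarch_abs (R : realType) (K : fieldType) (v : K -> R) : Prop :=
  NonarchAbs {
    nonarch_abs_ge0 : forall x, 0 <= v x;
    nonarch_abs_eq0 : forall x, v x = 0 <-> x = 0;
    nonarch_absM : forall x y, v (x * y) = v x * v y;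
    nonarch_absD : forall x y, v (x + y) <= Num.max (v x) (v y) }.

Definition complete_abs (R : realType) (K : fieldType) (v : K -> R) : Prop :=
  forall u : nat -> K,
    (forall e : R, 0 < e -> exists N, forall i j, (N <= i)%N -> (N <= j)%N ->
       v (u i - u j) < e) ->
    exists l, forall e : R, 0 < e -> exists N, forall i, (N <= i)%N ->
      v (u i - l) < e.

(* The residue field o/p, as the set of cosets x + p with x in o. *)
Definition residue_field (R : realType) (K : fieldType) (v : K -> R) :
    set (set K) :=
  [set [set y | v (y - x) < 1] | x in [set x | v x <= 1]].

(* [v] is the normalized absolute value, |uniformizer| = 1/q, of a
   non-archimedean local field whose residue field has [q] elements. *)
Record local_field (R : realType) (K : fieldType) (v : K -> R) (q : nat) :
    Prop := LocalField {
  local_field_abs : nonarch_abs v;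
  local_field_complete : complete_abs v;
  local_field_residue : residue_field v #= `I_q;
  local_field_uniformizer : exists w, v w = q%:R^-1;
  local_field_discrete : forall x, v x < 1 -> v x <= q%:R^-1 }.

Record unramified_quadratic (R : realType) := UnramifiedQuadratic {
  baseF : fieldType;
  absF : baseF -> R;
  resq : nat;
  baseF_char0 : [pchar baseF] =i pred0;
  baseF_local : local_field absF resq;
  (* such a p is the residual characteristic *)
  baseF_odd : forall p, prime p -> absF p%:R < 1 -> odd p;
  extE : splittingFieldType baseF;
  absE : extE -> R;
  eps : baseF;
  sqrt_eps : extE;
  bar : gal_of {: extE};
  eps_unit : absF eps = 1;
  eps_nonsquare : forall x, x ^+ 2 != eps;
  sqrt_epsK : sqrt_eps ^+ 2 = eps%:A;
  extE_gen : <<1; sqrt_eps>>%VS = {: extE}%VS;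
  bar_gal : bar \in 'Gal({: extE} / 1)%g;
  bar_neq1 : bar != 1%g;
  (* As |N(r)|_F = |r|_F^2, the normalized absolute value of E is the unique
     extension to E of the square of that of F; in particular its value at a
     uniformizer is q^-2. *)
  absE_abs : nonarch_abs absE;
  absE_F : forall r : baseF, absE r%:A = absF r ^+ 2 }.

Section Borel.
Context (R : realType) (T : zmodType) (dist : T -> T -> R).

Definition carrier_of of T -> T -> R : Type := T.

Definition dist_open : set (set T) :=
  [set O | forall x, O x -> exists2 e : R, 0 < e &
             forall y, dist x y < e -> O y].

HB.instance Definition _ := GRing.Zmodule.on (carrier_of dist).
HB.instance Definition _ := isPointed.Build (carrier_of dist) (0 : T).

Definition borel := g_sigma_algebraType (dist_open : set (set (carrier_of dist))).
HB.instance Definition _ := Measurable.on borel.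

End Borel.

Definition field_dist (R : realType) (K : fieldType) (v : K -> R) (x y : K) : R :=
  v (x - y).

Definition mx_dist (R : realType) (K : fieldType) (v : K -> R) (m n : nat)
    (A B : 'M[K]_(m, n)) : R :=
  \big[Num.max/0]_(ij : 'I_m * 'I_n) v (A ij.1 ij.2 - B ij.1 ij.2).

(* a ^ s = exp (s log a), for a > 0 *)
Definition cpow (R : realType) (a : R) (s : R[i]) : R[i] :=
  (expR (Re s * ln a) * cos (Im s * ln a))
    +i* (expR (Re s * ln a) * sin (Im s * ln a)).

Definition cintegrable d (T : measurableType d) (R : realType)
    (mu : {measure set T -> \bar R}) (D : set T) (f : T -> R[i]) : Prop :=
  mu.-integrable D (fun x => (Re (f x))%:E) /\
  mu.-integrable D (fun x => (Im (f x))%:E).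

Definition cintegral d (T : measurableType d) (R : realType)
    (mu : {measure set T -> \bar R}) (D : set T) (f : T -> R[i]) : R[i] :=
  Rintegral mu D (fun x => Re (f x)) +i* Rintegral mu D (fun x => Im (f x)).

(* A Haar measure on K^*, seen as a Borel measure on K of which only the
   restriction to K^* matters, such that the units have volume 1. *)
Definition haar_units (R : realType) (K : fieldType) (v : K -> R)
    (mu : {measure set (borel (field_dist v)) -> \bar R}) : Prop :=
  (forall (a : K) (A : set (borel (field_dist v))), a != 0 ->
     measurable A -> A `<=` [set x : K | x != 0] ->
     mu [set a * x | x in (A : set K)] = mu A) /\
  mu [set x : K | v x = 1] = 1%E.

(* The Haar measure of volume 1 of a compact group [C] of matrices, seen as a
   Borel measure on all matrices of which only the restriction to [C] matters. *)
Definition haar_compact (R : realType) (K : fieldType) (v : K -> R) (m : nat)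
    (C : set 'M[K]_m)
    (mu : {measure set (borel (@mx_dist R K v m m)) -> \bar R}) : Prop :=
  (forall (k : 'M[K]_m) (A : set (borel (@mx_dist R K v m m))), C k ->
     measurable A -> A `<=` C ->
     mu [set k *m x | x in (A : set 'M[K]_m)] = mu A) /\
  mu C = 1%E.

Section Groups.
Context (R : realType) (D : unramified_quadratic R).
Local Notation F := (baseF D).
Local Notation E := (extE D).
Local Notation absE := (@absE R D).
Local Notation "x ^bar" := (bar D x) (at level 2, format "x ^bar").

Definition pF (m : int) : set F := [set x | absF x <= (resq D)%:R ^ (- m)].
(* q ^ -2 is the absolute value of a uniformizer of E. *)
Definition pE (m : int) : set E :=
  [set x | absE x <= ((resq D)%:R ^+ 2) ^ (- m)].

Definition J_mx : 'M[E]_3 :=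
  matrix_of_rows 3 3 [:: [:: 0; 0; 1]; [:: 0; 1; 0]; [:: 1; 0; 0]].

Definition U3 : set 'M[E]_3 :=
  [set g | g \in unitmx /\ (map_mx (bar D) g)^T *m J_mx *m g = J_mx].

Definition u_mx (x y : E) : 'M[E]_3 :=
  matrix_of_rows 3 3 [:: [:: 1; x; y]; [:: 0; 1; - x^bar]; [:: 0; 0; 1]].

(* 2 x 2 matrices embedded in the corners of 3 x 3 matrices; this is the
   identification of U(1,1) with H. *)
Definition corners (h : 'M[E]_2) : 'M[E]_3 :=
  matrix_of_rows 3 3 [:: [:: h 0 0; 0; h 0 1]; [:: 0; 1; 0];
                         [:: h 1 0; 0; h 1 1]].

Definition H_grp : set 'M[E]_3 := U3 `&` range corners.

Definition t2_mx (a : E) : 'M[E]_2 :=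
  matrix_of_rows 2 2 [:: [:: a; 0]; [:: 0; (a^bar)^-1]].
Definition t_mx (a : E) : 'M[E]_3 := corners (t2_mx a).
Definition d_mx (a : E) : 'M[E]_2 :=
  matrix_of_rows 2 2 [:: [:: a; 0]; [:: 0; 1]].

Definition K_grp (n : nat) : set 'M[E]_3 :=
  U3 `&` [set g |
    [/\ pE 0 (g 0 0), pE 0 (g 0 1) & pE (- n%:Z) (g 0 2)] /\
    [/\ pE n (g 1 0), pE n (g 1 1 - 1) & pE 0 (g 1 2)] /\
    [/\ pE n (g 2 0), pE n (g 2 1) & pE 0 (g 2 2)]].

Definition K_H (n : nat) : set 'M[E]_3 := K_grp n `&` H_grp.

Section Representations.
Context (V : lmodType R[i]) (pi : 'M[E]_3 -> {linear V -> V}).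

(* Only the values of [pi] on [U3] matter. *)
Definition representation : Prop :=
  (forall v, pi 1%:M v = v) /\
  (forall g h, U3 g -> U3 h -> forall v, pi (g *m h) v = pi g (pi h v)).

Definition smooth : Prop :=
  forall v, exists2 e : R, 0 < e &
    forall g, U3 g -> mx_dist absE g 1%:M < e -> pi g v = v.

Definition invariant_subspace (S : set V) : Prop :=
  [/\ S 0, forall (a : R[i]) v w, S v -> S w -> S (a *: v + w)
    & forall g v, U3 g -> S v -> S (pi g v)].

Definition irreducible : Prop :=
  (exists v : V, v <> 0) /\
  (forall S, invariant_subspace S -> S = [set 0] \/ S = setT).

Definition irreducible_representation : Prop :=
  [/\ representation, smooth & irreducible].

Definition nontrivial_character (psi : E -> R[i]) : Prop :=
  [/\ forall x y, psi (x + y) = psi x * psi y,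
      forall x, `|psi x| = 1,
      forall e : R, 0 < e -> exists2 r : R, 0 < r &
        forall x, absE x < r -> `|psi x - 1| < e%:C
    & exists x, psi x != 1].

Definition whittaker_functional (psi : E -> R[i]) (l : {scalar V}) : Prop :=
  forall x y, y + y^bar + x * x^bar = 0 ->
    forall v, l (pi (u_mx x y) v) = psi x * l v.

Definition nonzero_functional (l : {scalar V}) : Prop := exists v, l v != 0.

Definition generic (psi : E -> R[i]) : Prop :=
  exists l, whittaker_functional psi l /\ nonzero_functional l.

(* The choice of [l] is immaterial when Hom_U(pi, psi) is one-dimensional; only
   the values of [W] on [U3] matter. *)
Definition whittaker_model (psi : E -> R[i]) : set ('M[E]_3 -> R[i]) :=
  [set W | exists (l : {scalar V}) (v : V),
     [/\ whittaker_functional psi l, nonzero_functional l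
       & forall g, U3 g -> W g = l (pi g v)]].

End Representations.

Section Zeta.
Context (muF : {measure set (borel (field_dist (@absF R D))) -> \bar R})
        (muE : {measure set (borel (field_dist absE)) -> \bar R}).

Definition z_integrand (s : R[i]) (g : 'M[F]_2) (Phi : 'rV[F]_2 -> R[i])
    (r : F) : R[i] :=
  Phi (matrix_of_rows 1 2 [:: [:: 0; r]] *m g) * cpow (absE r%:A) s.

Definition zF (s : R[i]) (g : 'M[F]_2) (Phi : 'rV[F]_2 -> R[i]) : R[i] :=
  cintegral muF [set r : F | r != 0] (z_integrand s g Phi).

Definition decomposition (h : 'M[E]_3) : set (E * 'M[F]_2) :=
  [set bh | [/\ bh.1 != 0, \det bh.2 = 1 &
     h = corners (t2_mx bh.1 *m d_mx (sqrt_eps D) *m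
                  map_mx (in_alg E) bh.2 *m d_mx (sqrt_eps D)^-1)]].

(* Some decomposition of h is chosen; the value does not depend on which. *)
Definition f_s (s : R[i]) (h : 'M[E]_3) (Phi : 'rV[F]_2 -> R[i]) : R[i] :=
  let bh := xget (1, 1%:M) (decomposition h) in
  cpow (absE bh.1) s * zF s bh.2 Phi.

Definition Z1_integrand (s : R[i]) (W : 'M[E]_3 -> R[i]) (a : E) : R[i] :=
  W (t_mx a) * cpow (absE a) (s - 1).

Definition Z1 (W : 'M[E]_3 -> R[i]) (s : R[i]) : R[i] :=
  cintegral muE [set a : E | a != 0] (Z1_integrand s W).

Definition Z1_converges (W : 'M[E]_3 -> R[i]) (s : R[i]) : Prop :=
  cintegrable muE [set a : E | a != 0] (Z1_integrand s W).

Section Zeta2.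
Context (n : nat) (muK : {measure set (borel (@mx_dist R E absE 3 3)) -> \bar R}).

Definition Z2_integrand (s : R[i]) (W : 'M[E]_3 -> R[i])
    (Phi : 'rV[F]_2 -> R[i]) (a : E) (k : 'M[E]_3) : R[i] :=
  W (t_mx a *m k) * f_s s (t_mx a *m k) Phi * cpow (absE a) (- 1).

(* Z(s, W, Phi), as an integral over U_H\H in the coordinates t(a) k of the
   Iwasawa decomposition H = U_H {t(a)} K_{n,H} *)
Definition Z2 (W : 'M[E]_3 -> R[i]) (Phi : 'rV[F]_2 -> R[i]) (s : R[i]) : R[i] :=
  cintegral muE [set a : E | a != 0]
    (fun a => cintegral muK (K_H n) (Z2_integrand s W Phi a)).

(* Absolute convergence, of the integrals defining f included *)
Definition Z2_converges (W : 'M[E]_3 -> R[i]) (Phi : 'rV[F]_2 -> R[i])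
    (s : R[i]) : Prop :=
  [/\ forall h1 : 'M[F]_2, \det h1 = 1 ->
        cintegrable muF [set r : F | r != 0] (z_integrand s h1 Phi),
      forall a : E, a != 0 -> cintegrable muK (K_H n) (Z2_integrand s W Phi a)
    & muE.-integrable [set a : E | a != 0]
        (fun a => (Rintegral muK (K_H n)
                     (fun k => Re `|Z2_integrand s W Phi a k|))%:E)].

Definition Phi_n : 'rV[F]_2 -> R[i] :=
  fun xy => (`[< pF n (xy 0 0) /\ pF 0 (xy 0 1) >])%:R.

End Zeta2.

(* q^{-2s} *)
Definition qm2s (s : R[i]) : R[i] := cpow (resq D)%:R (- (2 * s)).

Definition L_E (s : R[i]) : R[i] := 1 / (1 - qm2s s).

(* Elements of C(q^{-2s}) are rational functions over C in one variable,
   standing for q^{-2s}. The integral [I], absolutely convergent where [cvg]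
   holds, defines the rational function [r] if for Re(s) large it converges
   absolutely to the value of [r]; [r] is then unique. *)
Definition defines_rational (cvg : R[i] -> Prop) (I : R[i] -> R[i])
    (r : {fraction {poly R[i]}}) : Prop :=
  exists N P : {poly R[i]},
    [/\ P != 0, r = tofrac N / tofrac P & exists s0 : R, forall s : R[i], s0 < Re s ->
      [/\ cvg s, P.[qm2s s] != 0 & I s = N.[qm2s s] / P.[qm2s s]]].

(* The default 0 is only taken when [I] defines no rational function, which does
   not happen for the zeta integrals below. *)
Definition rational_of (cvg : R[i] -> Prop) (I : R[i] -> R[i]) :
    {fraction {poly R[i]}} :=
  xget 0 (defines_rational cvg I).

Definition Z1_rat (W : 'M[E]_3 -> R[i]) : {fraction {poly R[i]}} :=
  rational_of (Z1_converges W) (Z1 W).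

Definition Z2_rat n muK (W : 'M[E]_3 -> R[i]) (Phi : 'rV[F]_2 -> R[i]) :
    {fraction {poly R[i]}} :=
  rational_of (Z2_converges n muK W Phi) (Z2 n muK W Phi).

Definition L_E_rat : {fraction {poly R[i]}} := 1 / tofrac (1 - 'X).

End Zeta.
End Groups.

(* Main.v *)
Require Import Defs.
From mathcomp Require Import all_boot all_order all_algebra all_field.
From mathcomp Require Import all_classical all_reals all_analysis.
From mathcomp Require Import complex.
From mathcomp Require Import measurable_realfun.
From mathcomp Require Import ring.

Set Implicit Arguments.
Unset Strict Implicit.
Unset Printing Implicit Defensive.
Import Order.TTheory GRing.Theory Num.Theory.

Local Open Scope classical_set_scope.
Local Open Scope complex_scope.
Local Open Scope ring_scope.

(** Write [|.|] for the absolute value of E and let [k] be in [K_{n,H}]. As [W] is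
    fixed by [K_{n,H}], [W(t(a) k) = W(t(a))], so everything rests on the value
      [f(s, t(a) k, Phi_n) = |a|^s L_E(s, 1)],
    which does not depend on [k]; the integral over [K_{n,H}] is then trivial and
    the one over [a] is [Z(s, W)].

    To get this value, decompose [t(a) k = t(b) d h1 d^-1] and let [(g, d)] be the
    bottom row of [h1]. Then [Phi_n (r g, r d)] is [1] exactly when [r] times a
    scalar [c] is integral, where [|c|_F = max (|g|_F q^n, |d|_F)]
    ([Phi_n_ball]). Since the determinant of [k] is a unit, comparing bottom rows
    gives [|c| = |b| / |a|] ([decomposition_norm]). A change of variable turns
    [z(s, h1, Phi_n)] into [|c|^-s I] with [I] the integral of [|r|^s] over the
    nonzero integers, and splitting off the units gives [I = 1 + q^(-2s) I]
    ([ball_integral]), so that [I = L_E(s, 1)].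

    Two facts about the extension enter. The conjugation preserves the absolute
    value ([absE_bar]): this is the uniqueness of the extension of an absolute
    value, and follows here from Hensel's lemma for square roots. Every element of
    [H] has a decomposition ([decomposition_exists]), by Hilbert's theorem 90.

    For the identity of rational functions one also needs that, for [Re s] large,
    one zeta integral converges absolutely if and only if the other does. From
    [Z(s, W, Phi_n)] to [Z(s, W)] the only difficulty is measurability: it holds
    because [W(t(a))] depends on [|a|] alone ([Z1_integrand_abs]). *)

(** * Non-archimedean absolute values *)

Section NonarchAbs.
Context (R : realType) (K : fieldType) (v : K -> R).
Hypothesis vP : nonarch_abs v.

Lemma nabs_ge0 x : 0 <= v x. Proof. exact: (nonarch_abs_ge0 vP). Qed.

Lemma nabsM x y : v (x * y) = v x * v y. Proof. exact: (nonarch_absM vP). Qed.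

Lemma nabs0 : v 0 = 0. Proof. exact/(nonarch_abs_eq0 vP). Qed.

Lemma nabs_eq0 x : (v x == 0) = (x == 0).
Proof. by apply/eqP/eqP => /(nonarch_abs_eq0 vP). Qed.

Lemma nabs_gt0 x : (0 < v x) = (x != 0).
Proof. by rewrite lt_def nabs_ge0 nabs_eq0 andbT. Qed.

Lemma nabs1 : v 1 = 1.
Proof.
have v1_neq0 : v 1 != 0 by rewrite nabs_eq0 oner_neq0.
by apply: (mulfI v1_neq0); rewrite -nabsM !mulr1.
Qed.

Lemma nabsX x k : v (x ^+ k) = v x ^+ k.
Proof. by elim: k => [|k IH]; rewrite ?expr0 ?nabs1 // !exprS nabsM IH. Qed.

Lemma nabsN x : v (- x) = v x.
Proof.
have vN1 : v (-1) = 1.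
  apply/eqP; rewrite -(@pexpr_eq1 _ _ 2) ?nabs_ge0 //.
  by rewrite -nabsX sqrrN expr1n nabs1.
by rewrite -mulN1r nabsM vN1 mul1r.
Qed.

Lemma nabsB x y : v (x - y) = v (y - x).
Proof. by rewrite -nabsN opprB. Qed.

Lemma nabsV x : v x^-1 = (v x)^-1.
Proof.
have [->|x0] := eqVneq x 0; first by rewrite invr0 nabs0 invr0.
apply: (@mulfI _ (v x)); first by rewrite nabs_eq0.
by rewrite -nabsM !mulfV ?nabs_eq0 // nabs1.
Qed.

Lemma nabsD_le x y c : v x <= c -> v y <= c -> v (x + y) <= c.
Proof.
move=> xc yc; apply: (le_trans (nonarch_absD vP x y)).
by rewrite ge_max xc yc.
Qed.

Lemma nabsD_lt x y c : v x < c -> v y < c -> v (x + y) < c.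
Proof.
move=> xc yc; apply: (le_lt_trans (nonarch_absD vP x y)).
by rewrite gt_max xc yc.
Qed.

(** Otherwise [y = (x + y) - x] would be too small. *)
Lemma nabsD_eq x y : v x < v y -> v (x + y) = v y.
Proof.
move=> xy; apply/eqP; rewrite eq_le nabsD_le ?(ltW xy) //= leNgt.
apply/negP => lt; have : v ((x + y) - x) < v y by rewrite nabsD_lt ?nabsN.
by rewrite addrC addKr ltxx.
Qed.

Lemma nabs_near x y : v (y - x) < v x -> v y = v x.
Proof. by move=> /nabsD_eq; rewrite subrK. Qed.

Lemma nabs_nat_le1 k : v k%:R <= 1.
Proof.
elim: k => [|k IH]; first by rewrite nabs0 ler01.
by rewrite -addn1 natrD nabsD_le ?nabs1.
Qed.

(** A Cauchy criterion special to the ultrametric case: consecutive terms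
    suffice. *)
Lemma ultrametric_cvg (u : nat -> K) (c : R) : complete_abs v ->
  0 <= c -> c < 1 -> (forall k, v (u k.+1 - u k) <= c ^+ k) ->
  exists l, forall e : R, 0 < e -> exists N, forall i, (N <= i)%N ->
    v (u i - l) < e.
Proof.
move=> cplt c0 c1 uc; apply: cplt => e e0.
have [N cN] : exists N, c ^+ N < e.
  have := @cvg_expr R c; rewrite ger0_norm // => /(_ c1) /cvgrPdist_lt /(_ e e0).
  case=> N _ /(_ N (leqnn N)) /=; rewrite sub0r normrN ger0_norm ?exprn_ge0 //.
  by exists N.
have tail i : (N <= i)%N -> v (u i - u N) <= c ^+ N.
  elim: i => [|i IH]; first by rewrite leqn0 => /eqP <-; rewrite subrr nabs0 exprn_ge0.
  rewrite leq_eqVlt => /predU1P[<-|Ni]; first by rewrite subrr nabs0 exprn_ge0.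
  have -> : u i.+1 - u N = (u i.+1 - u i) + (u i - u N) by rewrite addrA subrK.
  rewrite nabsD_le ?IH //; apply: (le_trans (uc i)).
  by rewrite ler_wiXn2l // ltW.
exists N => i j Ni Nj; apply: le_lt_trans cN.
have -> : u i - u j = (u i - u N) + - (u j - u N) by rewrite opprB addrA subrK.
by rewrite nabsD_le ?nabsN ?tail.
Qed.

(** Hensel's lemma for [X ^+ 2 - e], by Newton's iteration
    [x |-> x - (x ^+ 2 - e) / (2 * x)], which squares the error. *)
Lemma hensel_sqrt (e a : K) : complete_abs v -> v 2%:R = 1 -> v e = 1 ->
  v (a ^+ 2 - e) < 1 -> exists x, x ^+ 2 = e.
Proof.
move=> cplt v2 ve ae.
pose step x := x - (x ^+ 2 - e) / (2%:R * x).
pose u k := iter k step a.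
pose c := v (a ^+ 2 - e).
have c0 : 0 <= c by exact: nabs_ge0.
have unit_of x : v (x ^+ 2 - e) < 1 -> v x = 1.
  rewrite -ve => /nabs_near; rewrite nabsX ve => /eqP.
  by rewrite pexpr_eq1 ?nabs_ge0 // => /eqP.
have stepE x : v (x ^+ 2 - e) < 1 ->
    v (step x ^+ 2 - e) = v (x ^+ 2 - e) ^+ 2 /\ v (step x - x) = v (x ^+ 2 - e).
  move=> xe; have vx := unit_of _ xe.
  have x0 : x != 0 by rewrite -nabs_eq0 vx oner_neq0.
  have t0 : 2%:R != 0 :> K by rewrite -nabs_eq0 v2 oner_neq0.
  split.
    have -> : step x ^+ 2 - e = (x ^+ 2 - e) ^+ 2 * ((2%:R * x) ^-1) ^+ 2.
      by rewrite /step; field; rewrite t0 x0.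
    by rewrite nabsM !nabsX nabsV nabsM v2 vx mulr1 invr1 expr1n mulr1.
  by rewrite /step addrC addKr nabsN nabsM nabsV nabsM v2 vx mulr1 invr1 mulr1.
have ue k : v (u k ^+ 2 - e) <= c ^+ k.+1.
  elim: k => [|k IH]; first by rewrite expr1.
  have uk1 : v (u k ^+ 2 - e) < 1.
    by apply: (le_lt_trans IH); rewrite exprn_ilt1.
  have [-> _] := stepE _ uk1; rewrite expr2 exprSr.
  rewrite ler_pM ?nabs_ge0 //; apply: (le_trans IH).
  by rewrite exprS ler_piMr // exprn_ile1 // ltW.
have ue1 k : v (u k ^+ 2 - e) < 1.
  by apply: (le_lt_trans (ue k)); rewrite exprn_ilt1.
have [l ul] : exists l, forall d : R, 0 < d -> exists N, forall i, (N <= i)%N ->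
    v (u i - l) < d.
  apply: (ultrametric_cvg (c := c) cplt) => // k.
  have [_ ->] := stepE _ (ue1 k); apply: (le_trans (ue k)).
  by rewrite ler_wiXn2l // ltW.
exists l; apply/eqP; rewrite -subr_eq0 -nabs_eq0; apply/eqP/le_anti.
rewrite nabs_ge0 andbT; apply/ler_addgt0Pr => d d0; rewrite add0r.
have [N1 uN1] := ul (Num.min d 1) (ltac:(by rewrite lt_min d0 ltr01)).
have [N2 uN2] : exists N, c ^+ N < d.
  have := @cvg_expr R c; rewrite ger0_norm // => /(_ ae) /cvgrPdist_lt /(_ d d0).
  case=> N _ /(_ N (leqnn N)) /=; rewrite sub0r normrN ger0_norm ?exprn_ge0 //.
  by exists N.
pose i := maxn N1 N2.
have := uN1 i (leq_maxl _ _); rewrite lt_min => /andP[uld ul1].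
have vu := unit_of _ (ue1 i).
have -> : l ^+ 2 - e = (u i ^+ 2 - e) + - ((u i - l) * (u i + l)).
  by ring.
apply: nabsD_le.
  apply: (le_trans (ue i)); apply: le_trans (ltW uN2).
  by rewrite ler_wiXn2l ?(ltW ae) // (leq_trans (leq_maxr N1 N2)).
rewrite nabsN nabsM; apply: (le_trans _ (ltW uld)).
rewrite ler_piMr ?nabs_ge0 // nabsD_le ?vu //.
have -> : l = u i + - (u i - l) by ring.
by rewrite nabsD_le ?vu ?nabsN // ltW.
Qed.

End NonarchAbs.

(** * The unramified quadratic extension *)

Section Extension.
Context (R : realType) (D : unramified_quadratic R).
Local Notation F := (baseF D).
Local Notation E := (extE D).
Local Notation absF := (@absF R D).
Local Notation absE := (@absE R D).
Local Notation q := (resq D).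
Local Notation se := (sqrt_eps D).
Local Notation "x ^bar" := (bar D x) (at level 2, format "x ^bar").

Lemma absF_nonarch : nonarch_abs absF.
Proof. exact: (local_field_abs (baseF_local D)). Qed.
Local Notation aF := absF_nonarch.
Local Notation aE := (absE_abs D).

Lemma absF2 : absF 2%:R = 1.
Proof.
apply/eqP; rewrite eq_le nabs_nat_le1 //=; last exact: aF.
by rewrite leNgt; apply/negP => /(baseF_odd (isT : prime 2)).
Qed.

(** Were the residue field to have at most one element, [0] and [1] would be
    congruent. *)
Lemma resq_gt1 : (1 < q)%N.
Proof.
have /card_set_bijP[f [f_fun f_inj _]] := local_field_residue (baseF_local D).
have res0 : residue_field absF [set y | absF (y - 0) < 1].
  by exists 0 => //=; rewrite nabs0 //; exact: aF.
have res1 : residue_field absF [set y | absF (y - 1) < 1].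
  by exists 1 => //=; rewrite nabs1 //; exact: aF.
rewrite ltnNge; apply/negP => q1.
have I0 x : residue_field absF x -> f x = 0%N.
  by move=> /f_fun /= fx; apply/eqP; rewrite -leqn0 -ltnS (leq_trans fx).
have /seteqP[/(_ 0 _) +_] : [set y | absF (y - 0) < 1] = [set y | absF (y - 1) < 1].
  by apply: f_inj; rewrite ?inE // !I0.
rewrite /= subr0 sub0r nabsN ?nabs0 ?nabs1 //; [|exact: aF..].
by rewrite ltxx => /(_ ltr01).
Qed.

Lemma q_gt0 : 0 < q%:R :> R.
Proof. by rewrite ltr0n (ltn_trans _ resq_gt1). Qed.

Lemma q_gt1 : 1 < q%:R :> R.
Proof. by rewrite ltr1n resq_gt1. Qed.

Lemma uniformizerF : exists2 w : F, w != 0 & absF w = q%:R^-1.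
Proof.
have [w wq] := local_field_uniformizer (baseF_local D).
by exists w => //; rewrite -(nabs_eq0 aF) wq invr_eq0 (gt_eqF q_gt0).
Qed.

Lemma absE_uniformizer (w : F) : absF w = q%:R^-1 -> absE w%:A = (q%:R ^+ 2)^-1.
Proof. by move=> wq; rewrite absE_F wq exprVn. Qed.

Lemma extE_coords (x : E) : exists a b : F, x = a%:A + b *: se.
Proof.
have : x \in <<1; se>>%VS by rewrite extE_gen memvf.
move=> /Fadjoin1_polyP[p ->]; elim/poly_ind : p => [|p c [a [b IH]]].
  by exists 0, 0; rewrite rmorph0 horner0 !scale0r addr0.
exists (b * eps D + c), a.
rewrite rmorphD rmorphM /= map_polyX map_polyC /= hornerMXaddC IH.
rewrite mulrDl -!scalerAl mul1r -expr2 sqrt_epsK scalerA scalerDl.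
by rewrite -addrA addrC.
Qed.

Lemma bar_alg (a : F) : (a%:A)^bar = a%:A.
Proof. by rewrite linearZ /= rmorph1. Qed.

Lemma se_neq0 : se != 0.
Proof.
apply/eqP => s0; have := sqrt_epsK D; rewrite s0 expr0n /= => /esym/eqP.
rewrite scaler_eq0 oner_eq0 orbF => /eqP e0.
by have := eps_unit D; rewrite e0 (nabs0 aF) => /esym/eqP; rewrite oner_eq0.
Qed.

Lemma bar_se : se^bar = - se.
Proof.
have : (se^bar) ^+ 2 == se ^+ 2 by rewrite -rmorphXn /= sqrt_epsK bar_alg.
rewrite eqf_sqr => /orP[/eqP fix_se|/eqP //].
have := bar_neq1 D; suff -> : bar D = 1%g by rewrite eqxx.
apply/eqP/gal_eqP => x _; have [a [b ->]] := extE_coords x.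
by rewrite rmorphD /= bar_alg linearZ /= fix_se gal_id.
Qed.

Lemma bar_coords (a b : F) : (a%:A + b *: se)^bar = a%:A - b *: se.
Proof. by rewrite rmorphD /= bar_alg linearZ /= bar_se scalerN. Qed.

Lemma barK (x : E) : x^bar^bar = x.
Proof.
have [a [b ->]] := extE_coords x.
by rewrite bar_coords -scaleNr bar_coords scaleNr opprK.
Qed.

Lemma bar_eq0 (x : E) : (x^bar == 0) = (x == 0).
Proof. by rewrite fmorph_eq0. Qed.

Lemma two_neq0 : 2%:R != 0 :> F.
Proof. by rewrite -(nabs_eq0 aF) absF2 oner_neq0. Qed.

Lemma bar_fixedP (x : E) : x^bar = x -> exists a : F, x = a%:A.
Proof.
have [a [b ->]] := extE_coords x; rewrite bar_coords => /addrI /eqP.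
rewrite eq_sym -addr_eq0 -mulr2n -scaler_nat scaler_eq0.
by rewrite (negPf two_neq0) /= => /eqP ->; exists a; rewrite addr0.
Qed.

Lemma absE_se : absE se = 1.
Proof.
apply/eqP; rewrite -(@pexpr_eq1 _ _ 2) ?nabs_ge0 //; last exact: aE.
by rewrite -(nabsX aE) sqrt_epsK absE_F eps_unit expr1n.
Qed.

(** The case [|a| = |b|] is where completeness enters: were [|a + b sqrt_eps|]
    smaller than [|b|], then [(a/b)^2] would be close to [eps], which would be a
    square. *)
Lemma absE_coords (a b : F) :
  absE (a%:A + b *: se) = Num.max (absF a) (absF b) ^+ 2.
Proof.
have absEZ (c : F) x : absE (c *: x) = absF c ^+ 2 * absE x.
  by rewrite -[c *: x]mulr_algl (nabsM aE) absE_F.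
have lt_sqr (c d : F) : (absF c ^+ 2 < absF d ^+ 2) = (absF c < absF d).
  by rewrite ltr_pXn2r ?nnegrE ?nabs_ge0 //; exact: aF.
case: (ltgtP (absF a) (absF b)) => [lt|gt|eq_ab].
- have absE_b : absE (b *: se) = absF b ^+ 2 by rewrite absEZ absE_se mulr1.
  by rewrite (nabsD_eq aE) absE_b // absE_F lt_sqr.
- have absE_b : absE (b *: se) = absF b ^+ 2 by rewrite absEZ absE_se mulr1.
  by rewrite addrC (nabsD_eq aE) absE_F // absE_b lt_sqr.
have [b0|b0] := eqVneq b 0.
  move: eq_ab; rewrite b0 (nabs0 aF) => /eqP; rewrite (nabs_eq0 aF) => /eqP ->.
  by rewrite !scale0r addr0 (nabs0 aE) (nabs0 aF) expr0n.
pose c := a / b.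
have c1 : absF c = 1.
  by rewrite (nabsM aF) (nabsV aF) eq_ab mulfV // nabs_eq0 //; exact: aF.
have -> : a%:A + b *: se = b *: (c%:A + se).
  by rewrite scalerDr scalerA /c mulrC divfK.
rewrite absEZ eq_ab; suff -> : absE (c%:A + se) = 1 by rewrite mulr1.
have le1 (e : E) : absE e = 1 -> absE (c%:A + e) <= 1.
  by move=> e1; rewrite (nabsD_le aE) ?e1 // absE_F c1 expr1n.
have le_p := le1 _ absE_se.
have le_m : absE (c%:A - se) <= 1 by apply: le1; rewrite (nabsN aE) absE_se.
have prod1 : absE (c%:A + se) * absE (c%:A - se) = 1.
  rewrite -(nabsM aE) mulrC -subr_sqr sqrt_epsK.
  have -> : (c%:A : E) ^+ 2 = (c ^+ 2)%:A by rewrite -!in_algE -rmorphXn.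
  rewrite -scalerBl absE_F.
  suff -> : absF (c ^+ 2 - eps D) = 1 by rewrite expr1n.
  apply/eqP; rewrite eq_le (nabsD_le aF) ?(nabsN aF) ?eps_unit //=; last first.
    by rewrite (nabsX aF) c1 expr1n.
  rewrite leNgt; apply/negP => small.
  have [x /eqP] := hensel_sqrt aF (local_field_complete (baseF_local D)) absF2
    (eps_unit D) small.
  by rewrite (negPf (eps_nonsquare x)).
apply/le_anti; rewrite le_p /= -prod1 ler_piMr // nabs_ge0 //; exact: aE.
Qed.

Lemma absE_bar (x : E) : absE x^bar = absE x.
Proof.
have [a [b ->]] := extE_coords x.
by rewrite bar_coords -scaleNr !absE_coords nabsN //; exact: aF.
Qed.

(** Hilbert's theorem 90: [1 + u] works unless it vanishes. *)
Lemma hilbert90 (u : E) : u * u^bar = 1 -> exists2 b : E, b != 0 & b = u * b^bar.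
Proof.
move=> uu; have [u1|u1] := eqVneq (1 + u) 0.
  (* here [u = -1], and conjugation negates [sqrt_eps] *)
  exists se; first exact: se_neq0.
  by rewrite bar_se -(addr0_eq u1) mulrNN mul1r.
by exists (1 + u) => //; rewrite rmorphD rmorph1 /= mulrDr mulr1 uu addrC.
Qed.

End Extension.

(** * The unitary group *)

Section Unitary.
Context (R : realType) (D : unramified_quadratic R).
Local Notation F := (baseF D).
Local Notation E := (extE D).
Local Notation absF := (@absF R D).
Local Notation absE := (@absE R D).
Local Notation q := (resq D).
Local Notation se := (sqrt_eps D).
Local Notation "x ^bar" := (bar D x) (at level 2, format "x ^bar").
Local Notation aF := (absF_nonarch D).
Local Notation aE := (absE_abs D).

Lemma ord2E (k : 'I_2) : k = if k == 0 then 0 else 1.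
Proof. by case: k => [[|[|]] //= ?]; exact: val_inj. Qed.

Lemma det_mx2 (A : comNzRingType) (M : 'M[A]_2) :
  \det M = M 0 0 * M 1 1 - M 0 1 * M 1 0.
Proof.
have l0 : lift 0 0 = 1 :> 'I_2 by exact: val_inj.
have l1 : lift 1 0 = 0 :> 'I_2 by exact: val_inj.
rewrite (expand_det_row _ 0) !big_ord_recl big_ord0 addr0 /cofactor !det_mx11 !mxE /=.
by rewrite l0 l1 expr0 expr1 mul1r mulN1r mulrN.
Qed.

Lemma J_mxK : J_mx D *m J_mx D = 1%:M.
Proof.
apply/matrixP => i j; rewrite !mxE !big_ord_recl big_ord0 !mxE /=.
by case: i => [[|[|[|]]] //= ?]; case: j => [[|[|[|]]] //= ?];
  rewrite !(mul0r, mulr0, mul1r, addr0, add0r).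
Qed.

Lemma U3P (g : 'M[E]_3) : U3 g <-> forall i j,
  (g 0 i)^bar * g 2 j + (g 1 i)^bar * g 1 j + (g 2 i)^bar * g 0 j = J_mx D i j.
Proof.
have -> : U3 g <-> (map_mx (bar D) g)^T *m J_mx D *m g = J_mx D.
  split=> [[_ //]|gJg]; split=> //.
  have := mulmx1_unit J_mxK => -[]; rewrite -{1}gJg => /[!unitmx_mul].
  by case/andP.
have gJgE i j : ((map_mx (bar D) g)^T *m J_mx D *m g) i j =
    (g 0 i)^bar * g 2 j + (g 1 i)^bar * g 1 j + (g 2 i)^bar * g 0 j.
  rewrite !mxE !big_ord_recl big_ord0 !mxE !big_ord_recl !big_ord0 !mxE /=.
  rewrite !(mul0r, mulr0, mulr1, addr0, add0r).
  have -> : lift ord0 (lift ord0 ord0) = 2 :> 'I_3 by exact: val_inj.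
  have -> : lift ord0 ord0 = 1 :> 'I_3 by exact: val_inj.
  ring.
by split=> [gJg i j|gJg]; [rewrite -gJgE gJg|apply/matrixP => i j; rewrite gJgE].
Qed.

Lemma U3_mul (g h : 'M[E]_3) : U3 g -> U3 h -> U3 (g *m h).
Proof.
move=> [ug gJg] [uh hJh]; split; first by rewrite unitmx_mul ug.
have -> : (map_mx (bar D) (g *m h))^T *m J_mx D *m (g *m h) =
    (map_mx (bar D) h)^T *m ((map_mx (bar D) g)^T *m J_mx D *m g) *m h.
  by rewrite map_mxM trmx_mul !mulmxA.
by rewrite gJg.
Qed.

Lemma corners_inj : injective (@corners R D).
Proof.
move=> g h /matrixP gh; move: (gh 0 0) (gh 0 2) (gh 2 0) (gh 2 2).
rewrite !mxE /= => g00 g01 g10 g11; apply/matrixP => i j.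
by rewrite (ord2E i) (ord2E j); case: ifP; case: ifP.
Qed.

Lemma cornersM (g h : 'M[E]_2) : corners (g *m h) = corners g *m corners h.
Proof.
have l0 : lift ord0 ord0 = 1 :> 'I_2 by exact: val_inj.
apply/matrixP => i j.
by case: i => [[|[|[|]]] //= ?]; case: j => [[|[|[|]]] //= ?];
  rewrite !(mxE, big_ord_recl, big_ord0) /= ?l0 !(mul0r, mulr0, mulr1, addr0, add0r).
Qed.

(** The equation [h^* J h = J] for [h = (p q; r t)], entry by entry. *)
Definition U11 (p q r t : E) : Prop :=
  [/\ p^bar * r + r^bar * p = 0, p^bar * t + r^bar * q = 1,
      q^bar * r + t^bar * p = 1 & q^bar * t + t^bar * q = 0].

Lemma U3_corners (h : 'M[E]_2) :
  U3 (corners h) <-> U11 (h 0 0) (h 0 1) (h 1 0) (h 1 1).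
Proof.
rewrite U3P; split=> [Uh|[h1 h2 h3 h4]].
  move: (Uh 0 0) (Uh 0 2) (Uh 2 0) (Uh 2 2).
  by rewrite !mxE /= rmorph0 !(mul0r, addr0).
by case=> [[|[|[|]]] //= ?]; case=> [[|[|[|]]] //= ?];
  rewrite !mxE /= ?rmorph0 ?rmorph1 !(mul0r, mulr0, mulr1, addr0, add0r).
Qed.

Lemma t_mxM (a b : E) : t_mx (a * b) = t_mx a *m t_mx b.
Proof.
rewrite /t_mx -cornersM; congr corners; apply/matrixP => i j.
rewrite !mxE !big_ord_recl big_ord0 !mxE /= rmorphM /= invfM.
by case: i => [[|[|]] //= ?]; case: j => [[|[|]] //= ?];
  rewrite !(mul0r, mulr0, addr0, add0r).
Qed.

Lemma U3_t_mx (a : E) : a != 0 -> U3 (t_mx a).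
Proof.
move=> a0; apply/U3_corners; rewrite /U11 !mxE /=; split.
- by rewrite rmorph0 mulr0 mul0r addr0.
- by rewrite rmorph0 mul0r addr0 mulfV // bar_eq0.
- by rewrite rmorph0 mul0r add0r fmorphV /= barK mulVf.
- by rewrite rmorph0 mul0r mulr0 addr0.
Qed.

Lemma t_mx_K_H n (u : E) : absE u = 1 -> K_H n (t_mx u).
Proof.
move=> u1.
have u0 : u != 0 by rewrite -(nabs_eq0 aE) u1 oner_neq0.
have pE_0 m : pE (D := D) m 0.
  by rewrite /pE /= (nabs0 aE) exprz_ge0 // exprn_ge0 // ler0n.
split; last by split; [exact: U3_t_mx|exists (t2_mx u)].
split; first exact: U3_t_mx.
rewrite /= !mxE /= subrr; split; last split; split=> //.
  by rewrite /pE /= u1 oppr0 expr0z.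
by rewrite /pE /= (nabsV aE) absE_bar u1 invr1 oppr0 expr0z.
Qed.

Section Det.
Variables p q r t : E.
Hypothesis h : U11 p q r t.
Local Notation u := (p * t - q * r).

(** Take determinants in [h^* J h = J]. *)
Lemma U11_det : u * u^bar = 1.
Proof.
have [h1 h2 h3 h4] := h; rewrite rmorphB !rmorphM /=.
have -> : (p * t - q * r) * (p^bar * t^bar - q^bar * r^bar) =
  (p^bar * t + r^bar * q) * (q^bar * r + t^bar * p) -
  (p^bar * r + r^bar * p) * (q^bar * t + t^bar * q) by ring.
by rewrite h1 h2 h3 h4 mul0r mulr1 subr0.
Qed.

(** The inverse of [h] is both [J h^* J] and its adjugate divided by [u]. *)
Lemma U11_adj : [/\ u * p^bar = p, u * q^bar = - q, u * r^bar = - r & u * t^bar = t].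
Proof.
have [h1 h2 h3 h4] := h; split.
- have -> : u * p^bar = p * (p^bar * t + r^bar * q) - q * (p^bar * r + r^bar * p) by ring.
  by rewrite h1 h2 mulr1 mulr0 subr0.
- have -> : u * q^bar = p * (q^bar * t + t^bar * q) - q * (q^bar * r + t^bar * p) by ring.
  by rewrite h3 h4 mulr1 mulr0 sub0r.
- have -> : u * r^bar = t * (p^bar * r + r^bar * p) - r * (p^bar * t + r^bar * q) by ring.
  by rewrite h1 h2 mulr1 mulr0 sub0r.
have -> : u * t^bar = t * (q^bar * r + t^bar * p) - r * (q^bar * t + t^bar * q) by ring.
by rewrite h3 h4 mulr1 mulr0 subr0.
Qed.

End Det.

Lemma SL2_product (b : E) (h1 : 'M[F]_2) :
  t2_mx b *m d_mx se *m map_mx (in_alg E) h1 *m d_mx se^-1 =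
  matrix_of_rows 2 2 [:: [:: b * (h1 0 0)%:A; b * se * (h1 0 1)%:A];
    [:: (b^bar)^-1 * (h1 1 0)%:A / se; (b^bar)^-1 * (h1 1 1)%:A]].
Proof.
have l0 : lift ord0 ord0 = 1 :> 'I_2 by exact: val_inj.
have o0 : ord0 = 0 :> 'I_2 by exact: val_inj.
have s0 := se_neq0 D.
apply/matrixP => i j; rewrite !mxE !big_ord_recl big_ord0 !mxE /=.
rewrite !big_ord_recl !big_ord0 !mxE /= !big_ord_recl !big_ord0 !mxE /= ?l0 ?o0.
case: i => [[|[|]] //= ?]; case: j => [[|[|]] //= ?];
  rewrite !(mul0r, mulr0, mulr1, addr0, add0r) //.
by rewrite mulrAC mulfK.
Qed.

(** Dividing [h] by [t(b)], where [b / b^bar] is the determinant of [h], gives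
    an element of SU(1,1), the conjugate of SL_2(F) by [d(sqrt_eps)]. *)
Lemma decomposition_exists (h : 'M[E]_2) : U3 (corners h) ->
  decomposition (corners h) !=set0.
Proof.
move=> /U3_corners Uh; have uu := U11_det Uh.
have [up uq ur ut] := U11_adj Uh.
set p := h 0 0 in up uq ur ut uu *; set q' := h 0 1 in up uq ur ut uu *.
set r := h 1 0 in up uq ur ut uu *; set t := h 1 1 in up uq ur ut uu *.
have [b b0 bE] := hilbert90 uu.
set u := p * t - q' * r in bE up uq ur ut uu.
have u0 : u != 0 by apply: contra_neq b0 => u0; rewrite bE u0 mul0r.
have bb0 : b^bar != 0 by rewrite bar_eq0.
have s0 := se_neq0 D.
have b_bar x : b * x^bar = u * x^bar * b^bar by rewrite {1}bE mulrAC.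
have [al alE] : exists a : F, p / b = a%:A.
  apply: bar_fixedP; rewrite fmorph_div /=; apply/eqP.
  by rewrite eqr_div // mulrC b_bar up.
have [be beE] : exists a : F, q' / (b * se) = a%:A.
  apply: bar_fixedP; rewrite fmorph_div rmorphM /= bar_se; apply/eqP.
  rewrite eqr_div ?mulf_neq0 ?oppr_eq0 //.
  by rewrite mulrA [_ * b]mulrC b_bar uq; apply/eqP; ring.
have [ga gaE] : exists a : F, b^bar * r * se = a%:A.
  apply: bar_fixedP; rewrite !rmorphM /= bar_se barK b_bar ur.
  by ring.
have [de deE] : exists a : F, b^bar * t = a%:A.
  by apply: bar_fixedP; rewrite rmorphM /= barK b_bar ut mulrC.
exists (b, matrix_of_rows 2 2 [:: [:: al; be]; [:: ga; de]]); split=> //=.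
  apply: (fmorph_inj (in_alg E)); rewrite -det_map_mx det_mx2 !mxE /= scale1r.
  rewrite -alE -beE -gaE -deE.
  have -> : p / b * (b^bar * t) - q' / (b * se) * (b^bar * r * se) = u * b^bar / b.
    by rewrite /u; field; rewrite b0 s0.
  by rewrite -bE mulfV.
rewrite SL2_product; congr corners; apply/matrixP => i j.
rewrite (ord2E i) (ord2E j); case: ifP => _; case: ifP => _;
  rewrite !mxE /= -?alE -?beE -?gaE -?deE.
- by rewrite mulrC divfK.
- by rewrite mulrC divfK // mulf_neq0.
- by rewrite -/r; field; rewrite bb0 s0.
- by rewrite mulKf.
Qed.

End Unitary.

(** * Bottom rows and the test function *)

Section Compact.
Context (R : realType) (D : unramified_quadratic R).
Local Notation F := (baseF D).
Local Notation E := (extE D).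
Local Notation absF := (@absF R D).
Local Notation absE := (@absE R D).
Local Notation q := (resq D).
Local Notation aF := (absF_nonarch D).
Local Notation aE := (absE_abs D).

(** The determinant [k00 k22 - k02 k20] of [k] is a unit, while [|k00| <= 1] and
    [|k02| <= q ^ (2 n)]. *)
Lemma K_H_bottom n (h : 'M[E]_2) : K_H n (corners h) ->
  Num.max (absE (h 1 0) * (q%:R ^+ n) ^+ 2) (absE (h 1 1)) = 1.
Proof.
move=> [[Uh [[b00 _ b02] [_ [b20 _ b22]]]] _].
have q0 := q_gt0 D.
move: b00 b02 b20 b22; rewrite /pE /= !mxE /= oppr0 !expr0z opprK -!exprnN -!exprnP.
rewrite exprAC => b00 b02 b20 b22.
have qn0 : 0 < (q%:R ^+ n) ^+ 2 :> R by rewrite !exprn_gt0.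
apply/le_anti/andP; split.
  by rewrite ge_max b22 andbT -ler_pdivlMr // mul1r.
have /U3_corners Uh2 := Uh; have := congr1 absE (U11_det Uh2).
rewrite (nabsM aE) absE_bar (nabs1 aE) -expr2 => /eqP.
rewrite (@pexpr_eq1 _ _ 2) ?(nabs_ge0 aE) // => /eqP det1.
rewrite -[leLHS]det1.
apply: (nabsD_le aE).
  by rewrite le_max (nabsM aE) ler_piMl ?(nabs_ge0 aE) ?orbT.
rewrite le_max (nabsN aE) (nabsM aE) mulrC.
by rewrite ler_wpM2l ?(nabs_ge0 aE).
Qed.

(** One of the conditions [|r g| <= q ^ -n] and [|r d| <= 1] on the bottom row
    [(g, d)] implies the other. The scalar [c] comes from the one that binds: it
    is [g / w ^ n], with [w] a uniformizer, or [d]. *)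
Lemma Phi_n_ball n (h1 : 'M[F]_2) : \det h1 = 1 ->
  exists c : F, [/\ c != 0,
    absF c = Num.max (absF (h1 1 0) * q%:R ^+ n) (absF (h1 1 1)) &
    forall r, Phi_n n (matrix_of_rows 1 2 [:: [:: 0; r]] *m h1) =
              (absF (c * r) <= 1)%R%:R].
Proof.
move=> det1; have [w w0 wq] := uniformizerF D.
have qn0 : 0 < q%:R ^+ n :> R by rewrite exprn_gt0 // q_gt0.
set g := h1 1 0; set d := h1 1 1.
have [c cE] : exists c : F, absF c = Num.max (absF g * q%:R ^+ n) (absF d).
  have [_|_] := leP (absF g * q%:R ^+ n) (absF d); first by exists d.
  by exists (g / w ^+ n); rewrite (nabsM aF) (nabsV aF) (nabsX aF) wq exprVn invrK.
exists c; split=> //.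
  apply/eqP => c0; move: cE; rewrite c0 (nabs0 aF) => /esym max0.
  have : absF g * q%:R ^+ n <= 0 by rewrite -max0 le_max lexx.
  have : absF d <= 0 by rewrite -max0 le_max lexx orbT.
  rewrite pmulr_lle0 // ![_ <= 0]le_eqVlt !ltNge !(nabs_ge0 aF) !orbF.
  rewrite !(nabs_eq0 aF) => /eqP d0 /eqP g0.
  move: det1; rewrite det_mx2 -/g -/d d0 g0 !mulr0 subrr => /esym/eqP.
  by rewrite oner_eq0.
move=> r; rewrite /Phi_n; congr (nat_of_bool _)%:R.
have l0 : lift ord0 ord0 = 1 :> 'I_2 by exact: val_inj.
have o0 : ord0 = 0 :> 'I_2 by exact: val_inj.
rewrite !mxE !big_ord_recl !big_ord0 !mxE /= l0 ?o0 -/g -/d !(mul0r, add0r, addr0).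
rewrite /pF /= oppr0 expr0z -exprnN !(nabsM aF) cE.
rewrite [RHS](_ : _ = (absF r * absF g <= q%:R ^- n) && (absF r * absF d <= 1)).
  by apply/asboolP/andP.
rewrite maxr_pMl ?(nabs_ge0 aF) // ge_max ![_ * absF r]mulrC; congr (_ && _).
by rewrite mulrA -ler_pdivlMr // mul1r.
Qed.

(** The bottom row of [t(a) k] is [(bar a)^-1] times that of [k], and also
    [(bar b)^-1] times that of [h1] up to units. *)
Lemma decomposition_norm n (a b : E) (h1 : 'M[F]_2) (k : 'M[E]_3) :
  a != 0 -> K_H n k -> decomposition (t_mx a *m k) (b, h1) ->
  Num.max (absF (h1 1 0) * q%:R ^+ n) (absF (h1 1 1)) ^+ 2 = absE b / absE a.
Proof.
move=> a0 Kk [/= b0 _]; have [_ [_ [h _ kE]]] := Kk; move: Kk; rewrite -kE => Kk.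
rewrite SL2_product -cornersM => /corners_inj /matrixP ab.
have aa0 : absE a != 0 by rewrite (nabs_eq0 aE).
have ab0 : absE b != 0 by rewrite (nabs_eq0 aE).
have l0 : lift ord0 ord0 = 1 :> 'I_2 by exact: val_inj.
have entry (x y z : E) : absE z = 1 ->
    (bar D a)^-1 * x = (bar D b)^-1 * y * z -> absE y = absE b / absE a * absE x.
  move=> z1 /(congr1 absE); rewrite !(nabsM aE) !(nabsV aE) !absE_bar z1 mulr1.
  by move=> /(congr1 ( *%R (absE b))); rewrite mulrA mulVKf.
have gE := ab 1 0; have dE := ab 1 1; move: gE dE.
rewrite !mxE !big_ord_recl !big_ord0 !mxE /= l0 !(mul0r, add0r, addr0) => gE dE.
have {}gE : absF (h1 1 0) ^+ 2 = absE b / absE a * absE (h 1 0).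
  by rewrite -absE_F; apply: entry gE; rewrite (nabsV aE) absE_se invr1.
have {}dE : absF (h1 1 1) ^+ 2 = absE b / absE a * absE (h 1 1).
  by rewrite -absE_F; apply: (entry _ _ 1); rewrite ?(nabs1 aE) ?mulr1.
rewrite -[RHS]mulr1 -[X in _ = _ * X](K_H_bottom Kk).
have sqr_max (x y : R) : 0 <= x -> 0 <= y -> Num.max x y ^+ 2 = Num.max (x ^+ 2) (y ^+ 2).
  move=> x0 y0; have [xy|yx] := leP x y.
    by rewrite max_r // ler_pXn2r.
  by rewrite max_l // ler_pXn2r // ltW.
rewrite sqr_max ?mulr_ge0 ?exprn_ge0 ?(nabs_ge0 aF) ?ler0n // exprMn gE dE.
by rewrite maxr_pMr ?mulrA // divr_ge0 ?(nabs_ge0 aE).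
Qed.

End Compact.

(** * Borel sets and the Haar measure of the multiplicative group *)

Section BorelOpen.
Context (R : realType) (T : zmodType) (dist : T -> T -> R).

Lemma open_borel (A : set (borel dist)) : dist_open dist A -> measurable A.
Proof. exact: sub_sigma_algebra. Qed.

End BorelOpen.

Section MultiplicativeHaar.
Context (R : realType) (K : fieldType) (v : K -> R).
Hypothesis vP : nonarch_abs v.
Local Notation BK := (borel (field_dist v)).
Local Notation Kstar := ([set x : K | x != 0] : set BK).

Lemma ball_nonzero (x y : K) : v (x - y) < v x -> v y = v x.
Proof. by rewrite (nabsB vP) => /(nabs_near vP). Qed.

(** Balls [B(x, |x|)] do not contain [0], and [|.|] is constant on them. *)
Lemma open_fixed_abs (A : set K) :
  (forall x, A x -> x != 0 /\ forall y, v (x - y) < v x -> A y) ->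
  measurable (A : set BK).
Proof.
move=> Aloc; apply: open_borel => x /Aloc[x0 Ax].
by exists (v x); rewrite ?(nabs_gt0 vP) //; exact: Ax.
Qed.

Lemma measurable_abs_pred (P : R -> Prop) :
  measurable ([set x : K | x != 0 /\ P (v x)] : set BK).
Proof.
apply: open_fixed_abs => x [x0 Px]; split=> // y /ball_nonzero xy /=.
by rewrite xy -(nabs_eq0 vP) xy (nabs_eq0 vP).
Qed.

Lemma measurable_nonzero : measurable Kstar.
Proof.
rewrite [Kstar](_ : _ = [set x | x != 0 /\ True]); first exact: measurable_abs_pred (fun=> True).
by apply/seteqP; split=> [x|x []].
Qed.

Lemma measurable_shell (x : K) : x != 0 -> measurable ([set y | v y = v x] : set BK).
Proof.
move=> x0; rewrite [X in measurable X](_ : _ = [set y | y != 0 /\ v y = v x]).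
  exact: (measurable_abs_pred (fun c => c = v x)).
apply/seteqP; split=> [y /= yx|y []//]; split=> //.
by rewrite -(nabs_eq0 vP) yx (nabs_eq0 vP).
Qed.

Lemma measurable_abs_fun d (T : measurableType d) (f : K -> T) :
  (forall x y, v x = v y -> f x = f y) -> measurable_fun Kstar (f : BK -> T).
Proof.
move=> fv _ Y _; apply: open_fixed_abs => x [/= x0 Yx]; split=> // y /ball_nonzero xy /=.
by rewrite (fv _ _ xy) -(nabs_eq0 vP) xy (nabs_eq0 vP).
Qed.

Lemma measurable_scale (a : K) : a != 0 ->
  measurable_fun [set: BK] (fun x : BK => (a * (x : K)) : BK).
Proof.
move=> a0; apply: (@measurability _ _ BK BK _ _ (dist_open (field_dist v))) => //.
move=> _ [V openV <-]; rewrite setTI; apply: open_borel => x /= /openV[e e0 ball_e].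
have va0 : 0 < v a by rewrite (nabs_gt0 vP).
exists (e / v a); first by rewrite divr_gt0.
move=> y; rewrite /field_dist => xy; apply: ball_e; rewrite /field_dist.
by rewrite -mulrBr (nabsM vP) mulrC -ltr_pdivlMr.
Qed.

Variable mu : {measure set BK -> \bar R}.
Hypothesis muP : haar_units mu.

Lemma haar_integral_scale (a : K) (f : BK -> \bar R) : a != 0 ->
  measurable_fun Kstar f ->
  (\int[mu]_(x in Kstar) f x = \int[mu]_(x in Kstar) f (a * (x : K))%R)%E.
Proof.
move=> a0 mf.
have mphi := measurable_scale a0.
pose phi (x : BK) : BK := a * (x : K).
have preim (A : set K) : phi @^-1` A = [set a^-1 * x | x in A].
  apply/seteqP; split=> [x Ax|_ [x Ax <-]]; last by rewrite /phi /= mulVKf.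
  by exists (phi x); rewrite // /phi mulKf.
have phiK : phi @^-1` Kstar = Kstar.
  by apply/seteqP; split=> x /=; rewrite /phi mulf_eq0 (negPf a0).
have push (g : BK -> \bar R) :
    (\int[mu]_(x in Kstar) g x = \int[pushforward mu phi]_(x in Kstar) g x)%E.
  apply: eq_measure_integral => A mA AK.
  transitivity (mu [set a^-1 * x | x in (A : set K)]); last by rewrite -preim.
  by rewrite (proj1 muP) // invr_eq0.
have scale0 (g : BK -> \bar R) : measurable_fun Kstar g -> (forall x, 0 <= g x)%E ->
    (\int[mu]_(x in Kstar) g x = \int[mu]_(x in Kstar) (g \o phi) x)%E.
  move=> mg g0; rewrite push (ge0_integral_pushforward mphi) ?phiK //.
  exact: measurable_nonzero.
rewrite [LHS]integralE [RHS]integralE.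
rewrite [X in (X - _)%E]scale0; [|exact: measurable_funepos|exact: funepos_ge0].
rewrite [X in (_ - X)%E]scale0; [|exact: measurable_funeneg|exact: funeneg_ge0].
by rewrite -funepos_comp -funeneg_comp.
Qed.

Lemma measurable_comp_scale (a : K) d (T : measurableType d) (f : BK -> T) : a != 0 ->
  measurable_fun Kstar f -> measurable_fun Kstar (fun x : BK => f (a * (x : K))).
Proof.
move=> a0 mf; apply: (measurable_comp (F := Kstar) _ _ mf).
- exact: measurable_nonzero.
- by move=> _ [x /= x0 <-] /=; rewrite mulf_neq0.
- exact: measurable_funTS (measurable_scale a0).
Qed.

Lemma haar_integrable_scale (a : K) (f : BK -> \bar R) : a != 0 ->
  mu.-integrable Kstar f -> mu.-integrable Kstar (fun x : BK => f (a * (x : K))).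
Proof.
move=> a0 /integrableP[mf foo]; apply/integrableP; split.
  exact: measurable_comp_scale.
rewrite -(haar_integral_scale (f := fun x => `|f x|%E)) //.
exact: measurableT_comp.
Qed.

Lemma haar_shell (x : K) : x != 0 -> mu [set y : K | v y = v x] = 1%E.
Proof.
move=> x0; have [scale <-] := muP; rewrite -(scale x [set y | v y = 1]) //.
- congr (mu _); apply/seteqP; split=> [y /= yx|_ [y /= y1 <-]].
    exists (x^-1 * y); last by rewrite mulVKf.
    by rewrite /= (nabsM vP) (nabsV vP) yx mulVf // (nabs_eq0 vP).
  by rewrite (nabsM vP) y1 mulr1.
- have := measurable_shell (oner_neq0 K); rewrite (nabs1 vP); exact.
- by move=> y /= y1; rewrite -(nabs_eq0 vP) y1 oner_neq0.
Qed.

End MultiplicativeHaar.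

(** * Measurability of the compact group *)

Section MatrixBorel.
Context (R : realType) (K : fieldType) (v : K -> R) (m : nat).
Hypothesis vP : nonarch_abs v.
Local Notation BM := (borel (@mx_dist R K v m m)).

Definition mx_continuous (phi : 'M[K]_m -> K) := forall g (e : R), 0 < e ->
  exists2 d : R, 0 < d & forall h, mx_dist v g h < d -> v (phi g - phi h) < e.

Lemma mx_continuous_entry i j : mx_continuous (fun g => g i j).
Proof.
move=> g e e0; exists e => // h; apply: le_lt_trans.
exact: (le_bigmax_cond _ (fun ij : 'I_m * 'I_m => v (g ij.1 ij.2 - h ij.1 ij.2)) (j := (i, j))).
Qed.

Lemma mx_continuousD phi chi : mx_continuous phi -> mx_continuous chi ->
  mx_continuous (fun g => phi g + chi g).
Proof.
move=> cphi cchi g e e0; have [d1 d10 phi_d] := cphi g e e0.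
have [d2 d20 chi_d] := cchi g e e0.
exists (Num.min d1 d2); first by rewrite lt_min d10.
move=> h; rewrite lt_min => /andP[gh1 gh2].
by rewrite opprD addrACA (nabsD_lt vP) ?phi_d ?chi_d.
Qed.

Lemma mx_continuousM phi chi : mx_continuous phi -> mx_continuous chi ->
  mx_continuous (fun g => phi g * chi g).
Proof.
move=> cphi cchi g e e0.
(* [c] bounds [phi g], and [chi h] for [h] near [g] *)
pose c := Num.max 1 (Num.max (v (phi g)) (v (chi g))).
have c_ge1 : 1 <= c by rewrite le_max lexx.
have c0 : 0 < c := lt_le_trans ltr01 c_ge1.
have [d1 d10 phi_d] := cphi g (Num.min c (e / c)) (ltac:(by rewrite lt_min c0 divr_gt0)).
have [d2 d20 chi_d] := cchi g (Num.min c (e / c)) (ltac:(by rewrite lt_min c0 divr_gt0)).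
exists (Num.min d1 d2); first by rewrite lt_min d10.
move=> h; rewrite lt_min => /andP[/phi_d + /chi_d].
rewrite !lt_min !ltr_pdivlMr // => /andP[_ phi_e] /andP[chi_c chi_e].
have -> : phi g * chi g - phi h * chi h =
  (phi g - phi h) * chi h + phi g * (chi g - chi h) by ring.
apply: (nabsD_lt vP); rewrite (nabsM vP).
  apply: le_lt_trans phi_e; rewrite ler_wpM2l ?(nabs_ge0 vP) //.
  have -> : chi h = chi g + - (chi g - chi h) by ring.
  by rewrite (nabsD_le vP) ?(nabsN vP) ?(ltW chi_c) // !le_max lexx !orbT.
apply: le_lt_trans chi_e; rewrite mulrC ler_wpM2l ?(nabs_ge0 vP) //.
by rewrite !le_max lexx orbT.
Qed.

Lemma mx_continuous_isometry (s : {rmorphism K -> K}) phi : (forall x, v (s x) = v x) ->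
  mx_continuous phi -> mx_continuous (fun g => s (phi g)).
Proof.
move=> vs cphi g e /(cphi g)[d d0 phi_d]; exists d => // h /phi_d.
by rewrite -rmorphB vs.
Qed.

Lemma measurable_mx_eq phi c : mx_continuous phi ->
  measurable ([set g | phi g = c] : set BM).
Proof.
move=> cphi; rewrite -[X in measurable X]setCK; apply: measurableC; apply: open_borel.
move=> g /eqP gc; have gc0 : 0 < v (phi g - c) by rewrite (nabs_gt0 vP) subr_eq0.
have [d d0 phi_d] := cphi g _ gc0.
by exists d => // h /phi_d + hc; rewrite hc ltxx.
Qed.

Lemma measurable_mx_ball phi c (b : R) : 0 < b -> mx_continuous phi ->
  measurable ([set g | v (phi g - c) <= b] : set BM).
Proof.
move=> b0 cphi; apply: open_borel => g /= gb.
have [d d0 phi_d] := cphi g _ b0; exists d => // h /phi_d /ltW gh.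
have -> : phi h - c = - (phi g - phi h) + (phi g - c) by ring.
by rewrite (nabsD_le vP) ?(nabsN vP).
Qed.

End MatrixBorel.

Section CompactMeasurable.
Context (R : realType) (D : unramified_quadratic R).
Local Notation F := (baseF D).
Local Notation E := (extE D).
Local Notation absE := (@absE R D).
Local Notation q := (resq D).
Local Notation aE := (absE_abs D).
Local Notation BM := (borel (@mx_dist R E absE 3 3)).

Lemma measurable_U3 : measurable (@U3 R D : set BM).
Proof.
pose gJg i j (g : 'M[E]_3) :=
  bar D (g 0 i) * g 2 j + bar D (g 1 i) * g 1 j + bar D (g 2 i) * g 0 j.
have -> : @U3 R D = \bigcap_(i in [set: 'I_3]) \bigcap_(j in [set: 'I_3])
    [set g | gJg i j g = J_mx D i j].
  by apply/seteqP; split=> [g /U3P gU i _ j _|g gU]; [|apply/U3P => i j]; exact: gU.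
apply: fin_bigcap_measurable => // i _; apply: fin_bigcap_measurable => // j _.
have cbar k l : mx_continuous absE (fun g : 'M[E]_3 => bar D (g k l)).
  exact: (mx_continuous_isometry (s := bar D) (@absE_bar R D) (mx_continuous_entry _ _ _)).
have cterm k l : mx_continuous absE (fun g : 'M[E]_3 => bar D (g k i) * g l j).
  exact: (mx_continuousM aE (cbar _ _) (mx_continuous_entry _ _ _)).
apply: (measurable_mx_eq aE).
exact: (mx_continuousD aE (mx_continuousD aE (cterm _ _) (cterm _ _)) (cterm _ _)).
Qed.

Lemma range_corners : range (@corners R D) =
  [set g : 'M[E]_3 | g 0 1 = 0] `&` [set g | g 1 0 = 0] `&` [set g | g 1 1 = 1] `&`
  [set g | g 1 2 = 0] `&` [set g | g 2 1 = 0].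
Proof.
apply/seteqP; split=> [_ [h _ <-]|g [[[[/= g01 g10] g11] g12] g21]].
  by rewrite /= !mxE.
exists (matrix_of_rows 2 2 [:: [:: g 0 0; g 0 2]; [:: g 2 0; g 2 2]]) => //.
apply/matrixP => i j; rewrite -[in LHS](inord_val i) -[in LHS](inord_val j).
have ord3E (k : 'I_3) : [\/ k = 0, k = 1 | k = 2].
  by case: k => [[|[|[|]]] //= ?]; [apply: Or31|apply: Or32|apply: Or33]; exact: val_inj.
by rewrite !inord_val; case: (ord3E i) => ->; case: (ord3E j) => ->; rewrite !mxE.
Qed.

Lemma measurable_K_H n : measurable (K_H n : set BM).
Proof.
have entry_eq i j c : measurable ([set g : 'M[E]_3 | g i j = c] : set BM).
  exact: (measurable_mx_eq aE c (mx_continuous_entry absE i j)).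
have q2_gt0 k : 0 < (q%:R ^+ 2) ^ k :> R by rewrite exprz_gt0 // exprn_gt0 // q_gt0.
have entry_ball i j c k : measurable ([set g : 'M[E]_3 | pE k (g i j - c)] : set BM).
  exact: (measurable_mx_ball aE c (q2_gt0 _) (mx_continuous_entry absE i j)).
have entry_ball0 i j k : measurable ([set g : 'M[E]_3 | pE k (g i j)] : set BM).
  by under eq_set do rewrite -[_ i j]subr0; exact: entry_ball.
apply: measurableI; last first.
  apply: measurableI; first exact: measurable_U3.
  by rewrite range_corners; do 4?[apply: measurableI]; exact: entry_eq.
apply: measurableI; first exact: measurable_U3.
rewrite [X in measurable X](_ : _ =
  [set g : 'M[E]_3 | pE 0 (g 0 0)] `&` [set g | pE 0 (g 0 1)] `&` [set g | pE (- n%:Z) (g 0 2)] `&`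
  [set g | pE n (g 1 0)] `&` [set g | pE n (g 1 1 - 1)] `&` [set g | pE 0 (g 1 2)] `&`
  [set g | pE n (g 2 0)] `&` [set g | pE n (g 2 1)] `&` [set g | pE 0 (g 2 2)]).
  by do 8?[apply: measurableI]; (exact: entry_ball0 || exact: entry_ball).
apply/seteqP; split=> g /=; first by move=> [[? ? ?] [[? ? ?] [? ? ?]]].
by move=> [[[[[[[[? ?] ?] ?] ?] ?] ?] ?] ?].
Qed.

End CompactMeasurable.

(** * Complex powers and complex integrals *)

Local Notation Re := complex.Re.
Local Notation Im := complex.Im.

Section ComplexPower.
Context (R : realType).
Implicit Types (a b : R) (s t : R[i]).

Lemma cis_add (x y x' y' : R) :
  ((expR (x + x') * cos (y + y')) +i* (expR (x + x') * sin (y + y')) : R[i]) =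
  ((expR x * cos y) +i* (expR x * sin y)) * ((expR x' * cos y') +i* (expR x' * sin y')).
Proof.
by apply/eqP; rewrite eq_complex /= expRD cosD sinD; apply/andP; split; apply/eqP; ring.
Qed.

Lemma cpowD a s t : cpow a (s + t) = cpow a s * cpow a t.
Proof. by case: s t => [x y] [x' y']; rewrite /cpow /= !mulrDl cis_add. Qed.

Lemma cpowM a b s : 0 < a -> 0 < b -> cpow (a * b) s = cpow a s * cpow b s.
Proof. by move=> a0 b0; rewrite /cpow lnM ?posrE // !mulrDr cis_add. Qed.

Lemma cpow1 s : cpow 1 s = 1 :> R[i].
Proof. by rewrite /cpow ln1 !mulr0 expR0 cos0 sin0 !mul1r. Qed.

Lemma cpowV a s : 0 < a -> cpow a^-1 s * cpow a s = 1.
Proof. by move=> a0; rewrite -cpowM ?invr_gt0 // mulVf ?cpow1 // gt_eqF. Qed.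

Lemma Re_norm_cpow a s : Re `|cpow a s| = expR (Re s * ln a).
Proof.
rewrite normc_def /= !exprMn -mulrDr cos2Dsin2 mulr1 sqrtr_sqr ger0_norm //.
Qed.

Lemma Re_normM s t : Re `|s * t| = Re `|s| * Re `|t|.
Proof. by rewrite normrM !normc_def /= mulr0 subr0. Qed.

Lemma Re_norm_ge0 s : 0 <= Re `|s|.
Proof. by rewrite normc_def sqrtr_ge0. Qed.

Lemma Re_norm_eq0 s : (Re `|s| == 0) = (s == 0).
Proof.
apply/eqP/eqP => [s0|->]; last by rewrite normr0.
by apply/normr0_eq0/eqP; rewrite eq_complex s0 normc_def /= !eqxx.
Qed.

Lemma norm_Re_le s : `|Re s| <= Re `|s|.
Proof.
rewrite normc_def /= -sqrtr_sqr ler_wsqrtr // lerDl; exact: sqr_ge0.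
Qed.

Lemma norm_Im_le s : `|Im s| <= Re `|s|.
Proof.
rewrite normc_def /= -sqrtr_sqr ler_wsqrtr // lerDr; exact: sqr_ge0.
Qed.

Lemma Re_norm_le s : Re `|s| <= `|Re s| + `|Im s|.
Proof.
rewrite normc_def /= -[leRHS]ger0_norm ?addr_ge0 // -sqrtr_sqr ler_wsqrtr //.
rewrite sqrrD !real_normK ?num_real // addrAC lerDl.
by rewrite mulrn_wge0 // mulr_ge0.
Qed.

End ComplexPower.

Section ComplexIntegral.
Context d (T : measurableType d) (R : realType) (mu : {measure set T -> \bar R}).
Context (A : set T) (mA : measurable A).
Implicit Types f g : T -> R[i].

Lemma eq_cintegral f g : (forall x, A x -> f x = g x) ->
  cintegral mu A f = cintegral mu A g.
Proof.
move=> fg; rewrite /cintegral; congr (_ +i* _);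
  by apply: eq_Rintegral => x /set_mem Ax; rewrite fg.
Qed.

Lemma eq_cintegrable f g : (forall x, A x -> f x = g x) ->
  cintegrable mu A f -> cintegrable mu A g.
Proof.
by move=> fg [fr fi]; split; [apply: eq_integrable fr|apply: eq_integrable fi] => // x /set_mem Ax;
  rewrite fg.
Qed.

Lemma cintegrableZ (c : R[i]) f : cintegrable mu A f ->
  cintegrable mu A (fun x => c * f x).
Proof.
case: c => [c c'] [fr fi]; split.
  apply: (@eq_integrable _ _ _ mu A mA (fun x => c%:E * (Re (f x))%:E - c'%:E * (Im (f x))%:E)%E).
    by move=> x _; case: (f x) => a b; rewrite -!EFinM -EFinB.
  by apply: integrableB => //; exact: integrableZl.
apply: (@eq_integrable _ _ _ mu A mA (fun x => c%:E * (Im (f x))%:E + c'%:E * (Re (f x))%:E)%E).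
  by move=> x _; case: (f x) => a b; rewrite -!EFinM -EFinD.
by apply: integrableD => //; exact: integrableZl.
Qed.

Lemma cintegralZ (c : R[i]) f : cintegrable mu A f ->
  cintegral mu A (fun x => c * f x) = c * cintegral mu A f.
Proof.
case: c => [c c'] [fr fi].
have Zint (a : R) (h : T -> R) : mu.-integrable A (EFin \o h) ->
    mu.-integrable A (EFin \o (fun x => a * h x)).
  by move=> hi; exact: (@integrableZl _ _ _ mu A mA a _ hi).
apply/eqP; rewrite eq_complex /=; apply/andP; split; apply/eqP.
  rewrite -!RintegralZl // -RintegralB ?Zint //.
  by apply: eq_Rintegral => x _; case: (f x).
rewrite -!RintegralZl // -RintegralD ?Zint //.
by apply: eq_Rintegral => x _; case: (f x).
Qed.

Lemma cintegralB f g : cintegrable mu A f -> cintegrable mu A g ->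
  cintegral mu A (fun x => f x - g x) = cintegral mu A f - cintegral mu A g.
Proof.
move=> [fr fi] [gr gi].
apply/eqP; rewrite eq_complex /=; apply/andP; split; apply/eqP.
  by rewrite -RintegralB //; apply: eq_Rintegral => x _; case: (f x); case: (g x).
by rewrite -RintegralB //; apply: eq_Rintegral => x _; case: (f x); case: (g x).
Qed.

Lemma cintegral_cst (c : R[i]) : mu A = 1%E -> cintegral mu A (fun=> c) = c.
Proof. by move=> muA; rewrite /cintegral !Rintegral_cst // muA !mulr1; case: c. Qed.

Lemma cintegrable_cst (c : R[i]) : mu A = 1%E -> cintegrable mu A (fun=> c).
Proof.
move=> muA; split; apply/integrableP; split=> //; rewrite integral_cst // muA mule1 //;
  by rewrite ?abse_EFin ltry.
Qed.

Lemma cintegrable_norm f : cintegrable mu A f ->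
  mu.-integrable A (fun x => (Re `|f x|)%:E).
Proof.
move=> [fr fi].
have fN : mu.-integrable A (fun x => `|(Re (f x))%:E| + `|(Im (f x))%:E|)%E.
  by apply: integrableD => //; exact: integrable_abse.
apply: le_integrable fN => //; last first.
  move=> x _; rewrite !abse_EFin lee_fin ger0_norm ?Re_norm_ge0 //.
  by rewrite ger0_norm ?addr_ge0 // Re_norm_le.
have mr : measurable_fun A (fun x => Re (f x)).
  by apply/measurable_EFinP; exact: measurable_int fr.
have mi : measurable_fun A (fun x => Im (f x)).
  by apply/measurable_EFinP; exact: measurable_int fi.
apply/measurable_EFinP.
rewrite (_ : (fun x => Re `|f x|) =
  (@Num.sqrt R) \o (fun x => Re (f x) ^+ 2 + Im (f x) ^+ 2)); last first.
  by apply/funext => x; rewrite normc_def.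
apply: measurableT_comp.
  exact: (continuous_measurable_fun (@sqrt_continuous R)).
by apply: measurable_funD; exact: measurable_funX.
Qed.

Lemma cintegrable_le f : measurable_fun A (fun x => Re (f x)) ->
  measurable_fun A (fun x => Im (f x)) ->
  mu.-integrable A (fun x => (Re `|f x|)%:E) -> cintegrable mu A f.
Proof.
move=> mr mi fN; split; apply: le_integrable fN => //.
- exact/measurable_EFinP.
- by move=> x _; rewrite !abse_EFin lee_fin [leRHS]ger0_norm ?Re_norm_ge0 ?norm_Re_le.
- exact/measurable_EFinP.
- by move=> x _; rewrite !abse_EFin lee_fin [leRHS]ger0_norm ?Re_norm_ge0 ?norm_Im_le.
Qed.

End ComplexIntegral.

(** * The local zeta integral over a ball *)

Section BallIntegral.
Context (R : realType) (D : unramified_quadratic R).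
Local Notation F := (baseF D).
Local Notation E := (extE D).
Local Notation absF := (@absF R D).
Local Notation absE := (@absE R D).
Local Notation q := (resq D).
Local Notation aF := (absF_nonarch D).
Local Notation aE := (absE_abs D).
Local Notation BF := (borel (field_dist absF)).
Local Notation Fstar := ([set r : F | r != 0] : set BF).

Lemma absE_alg_gt0 (c : F) : c != 0 -> 0 < absE c%:A.
Proof. by move=> c0; rewrite absE_F exprn_gt0 // (nabs_gt0 aF). Qed.

Lemma qm2sE (s : R[i]) : cpow (q%:R ^+ 2)^-1 s = qm2s D s.
Proof.
have q0 := q_gt0 D.
have lnq : ln (q%:R ^+ 2)^-1 = - (ln q%:R *+ 2) :> R by rewrite lnV ?lnXn ?posrE ?exprn_gt0.
have [Re2 Im2] : Re (- (2 * s)) = - (Re s *+ 2) /\ Im (- (2 * s)) = - (Im s *+ 2).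
  by case: s => x y; rewrite mulr_natl /= !mulr2n.
by rewrite /qm2s /cpow lnq Re2 Im2 !mulrN !mulNr !mulrnAr !mulrnAl.
Qed.

Lemma Re_norm_qm2s (s : R[i]) : Re `|qm2s D s| = expR (- (Re s * ln q%:R *+ 2)).
Proof.
by rewrite -qm2sE Re_norm_cpow lnV ?lnXn ?posrE ?exprn_gt0 ?q_gt0 // mulrN mulrnAr.
Qed.

Lemma norm_qm2s_lt1 (s : R[i]) : 0 < Re s -> Re `|qm2s D s| < 1.
Proof.
move=> s0; rewrite Re_norm_qm2s -[ltRHS]expR0 ltr_expR oppr_lt0 pmulrn_lgt0 //.
by rewrite mulr_gt0 // ln_gt0 // q_gt1.
Qed.

(** What the integrand of [z(s, h1, Phi_n)] becomes after rescaling [r]. *)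
Definition ball_power (s : R[i]) (r : F) : R[i] :=
  (absF r <= 1)%R%:R * cpow (absE r%:A) s.

Lemma measurable_ball_power s (f : R[i] -> R) :
  measurable_fun Fstar (fun r : BF => f (ball_power s r)).
Proof.
apply: (measurable_abs_fun aF (f := fun r : F => f (ball_power s r))) => r r' rr'.
by rewrite /ball_power !absE_F rr'.
Qed.

Variable muF : {measure set BF -> \bar R}.
Hypothesis muFP : haar_units muF.

Let mFstar : measurable Fstar := measurable_nonzero aF.

Lemma cintegrable_scale (a : F) (f : BF -> R[i]) : a != 0 ->
  cintegrable muF Fstar f -> cintegrable muF Fstar (fun r : BF => f (a * (r : F))).
Proof.
by move=> a0 [fr fi]; split; [apply: (haar_integrable_scale aF muFP a0 fr)
  |apply: (haar_integrable_scale aF muFP a0 fi)].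
Qed.

Lemma cintegral_scale (a : F) (f : BF -> R[i]) : a != 0 ->
  cintegrable muF Fstar f ->
  cintegral muF Fstar (fun r : BF => f (a * (r : F))) = cintegral muF Fstar f.
Proof.
move=> a0 [/measurable_int fr /measurable_int fi].
by rewrite /cintegral /Rintegral -(haar_integral_scale aF muFP a0 fr)
  -(haar_integral_scale aF muFP a0 fi).
Qed.

(** Let [w] be a uniformizer and [I] the integral. The ball of radius [1] is the
    disjoint union of the units and of [w] times the ball, so that
    [I = 1 + |w|^s I]. *)
Lemma ball_integral s : cintegrable muF Fstar (ball_power s) ->
  cintegral muF Fstar (ball_power s) * (1 - qm2s D s) = 1.
Proof.
move=> cI; have [w w0 wq] := uniformizerF D.
have wV0 : w^-1 != 0 by rewrite invr_eq0.
pose I := cintegral muF Fstar (ball_power s); rewrite -/I.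
have cI' := cintegrable_scale wV0 cI.
rewrite mulrBr mulr1 [I * _]mulrC -{2}(cintegral_scale wV0 cI : _ = I).
rewrite -cintegralZ // -cintegralB //; last exact: cintegrableZ.
(* The integrand is now the difference of those of the ball and of [w] times the
   ball, that is, the indicator function of the units. *)
pose U := [set r : F | absF r = 1] : set BF.
have mU : measurable U.
  by have := measurable_shell aF (oner_neq0 F); rewrite (nabs1 aF).
have UF : U `<=` Fstar by move=> r /= r1; rewrite -(nabs_eq0 aF) r1 oner_neq0.
rewrite (@eq_cintegral _ _ _ _ _ _ (fun r => (\1_U r)%:C)).
  rewrite /cintegral /= /Rintegral integral_indic // setIidl // (proj2 muFP).
  by rewrite integral0.
move=> r /= r0; rewrite /ball_power -qm2sE -(absE_uniformizer wq).
have wr : absE (w^-1 * r)%:A = absE r%:A / absE w%:A.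
  by rewrite !absE_F (nabsM aF) (nabsV aF) exprMn exprVn mulrC.
have cw : cpow (absE w%:A) s * cpow (absE (w^-1 * r)%:A) s = cpow (absE r%:A) s.
  rewrite -cpowM ?absE_alg_gt0 ?mulf_neq0 // wr mulrC divfK //.
  by rewrite gt_eqF // absE_alg_gt0.
rewrite mulrCA cw -mulrBl (nabsM aF) (nabsV aF) wq invrK indicE.
have q1 := q_gt1 D.
have [lt|gt|eq] := ltgtP (absF r) 1.
- have le : q%:R * absF r <= 1.
    rewrite mulrC -ler_pdivlMr ?q_gt0 // mul1r.
    exact: (local_field_discrete (baseF_local D)).
  by rewrite le subrr mul0r memNset //= => r1; move: lt; rewrite r1 ltxx.
- rewrite leNgt (lt_trans gt) ?ltr_pMl ?(nabs_gt0 aF) //= subrr mul0r memNset //= => r1.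
  by move: gt; rewrite r1 ltxx.
rewrite eq mulr1 leNgt q1 subr0 mul1r mem_set //.
by rewrite absE_F eq expr1n cpow1.
Qed.

(** The shells [|r| = q ^ -k], of volume one, contribute a geometric series. *)
Lemma ball_power_cintegrable s : 0 < Re s -> cintegrable muF Fstar (ball_power s).
Proof.
move=> s0; apply: cintegrable_le => //; do ?[exact: measurable_ball_power].
have q0 := q_gt0 D; have q1 := q_gt1 D.
have [w w0 wq] := uniformizerF D.
pose h (r : F) := Re `|ball_power s r|.
pose S k : set BF := [set r : F | absF r = absF (w ^+ k)].
have wk0 k : w ^+ k != 0 by rewrite expf_neq0.
have mS k : measurable (S k) := measurable_shell aF (wk0 k).
have muS k : muF (S k) = 1%E := haar_shell aF muFP (wk0 k).
pose x := Re `|qm2s D s|.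
have x1 : x < 1 := norm_qm2s_lt1 s0.
have x0 : 0 <= x := Re_norm_ge0 _.
have absw k : absF (w ^+ k) = q%:R^-1 ^+ k by rewrite (nabsX aF) wq.
have hS k r : S k r -> h r = x ^+ k.
  move=> /= rk; rewrite /h /ball_power absE_F rk -absE_F.
  rewrite (_ : absF _ <= 1 = true) ?mul1r; last first.
    by rewrite absw exprn_ile1 ?invr_ge0 ?ltW ?invf_lt1.
  rewrite absE_F absw exprAC exprVn /x -qm2sE !Re_norm_cpow -expRM_natl.
  by rewrite lnXn ?invr_gt0 ?exprn_gt0 // mulrnAr mulr_natl.
have h0 r : r != 0 -> ~ (\bigcup_k S k) r -> h r = 0.
  move=> r0 notS; rewrite /h /ball_power; case: leP => r1; last by rewrite mul0r normr0.
  exfalso; apply: notS.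
  have rgt0 : 0 < absF r by rewrite (nabs_gt0 aF).
  have [k kr] : exists k, q%:R^-1 ^+ k < absF r.
    have := @cvg_expr R q%:R^-1; rewrite ger0_norm ?invr_ge0 ?(ltW q0) // invf_lt1 //.
    move=> /(_ q1) /cvgrPdist_lt /(_ _ rgt0) [N _ /(_ N (leqnn N))] /=.
    by rewrite sub0r normrN ger0_norm ?exprn_ge0 ?invr_ge0 ?(ltW q0) //; exists N.
  (* For the least such [k], discreteness of the absolute value leaves only
     [|r| = q ^ (1 - k)]. *)
  elim: k kr => [|k IH] kr; first by move: kr; rewrite expr0 ltNge r1.
  have [/IH //|rk] := ltP (q%:R^-1 ^+ k) (absF r).
  exists k => //; rewrite /S /= absw; apply/eqP; rewrite eq_le rk leNgt; apply/negP => rk'.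
  have : absF (r / w ^+ k) < 1.
    by rewrite (nabsM aF) (nabsV aF) absw ltr_pdivrMr ?mul1r // exprn_gt0 // invr_gt0.
  move=> /(local_field_discrete (baseF_local D)).
  rewrite (nabsM aF) (nabsV aF) absw ler_pdivrMr ?exprn_gt0 ?invr_gt0 // -exprS.
  by rewrite leNgt kr.
have SF : \bigcup_k S k `<=` Fstar.
  by move=> r [k _ /= rk]; rewrite -(nabs_eq0 aF) rk (nabs_eq0 aF).
have mSU : measurable (\bigcup_k S k) by exact: bigcup_measurable.
have mh : measurable_fun Fstar (fun r : BF => (h r)%:E).
  by apply/measurable_EFinP; exact: (measurable_ball_power s (fun z => Re `|z|)).
apply/integrableP; split=> //.
rewrite (eq_integral (fun r => ((fun r => (h r)%:E) \_ (\bigcup_k S k)) r)); last first.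
  move=> r /set_mem /= r0; transitivity (h r)%:E.
    by rewrite -[RHS]gee0_abs ?lee_fin ?Re_norm_ge0.
  by rewrite patchE; case: ifPn => // /negP notS; rewrite h0 // => /mem_set.
rewrite -integral_mkcondr setIidr //.
rewrite ge0_integral_bigcup //; first last.
- apply/trivIsetP => i j _ _ ij; apply/seteqP; split=> // r [ri rj].
  have := etrans (esym ri) rj; rewrite !absw => ijE; case/eqP: ij; apply: (ieexprIn _ _ ijE).
    by rewrite invr_gt0.
  by rewrite invr_eq1 gt_eqF.
- by move=> r _; rewrite lee_fin Re_norm_ge0.
- exact: measurable_funS mh.
apply: (@le_lt_trans _ _ ((1 - x)^-1)%:E); last exact: ltry.
rewrite (eq_eseriesr (g := fun k => (x ^+ k)%:E)); last first.
  move=> k _; rewrite (eq_integral (cst (x ^+ k)%:E)); last first.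
    by move=> r /set_mem rk; rewrite (hS k).
  by rewrite integral_cst // muS mule1.
apply: lime_le; first by apply: is_cvg_nneseries => k _ _; rewrite lee_fin exprn_ge0.
apply: nearW => N; rewrite sumEFin lee_fin big_mkord.
rewrite -[leRHS]mul1r ler_pdivlMr ?subr_gt0 // mulrC -opprB mulNr -subrX1 opprB.
by rewrite gerBl exprn_ge0.
Qed.

End BallIntegral.

(** * The zeta integrals *)

Section ZetaIntegrals.
Context (R : realType) (D : unramified_quadratic R).
Local Notation F := (baseF D).
Local Notation E := (extE D).
Local Notation absF := (@absF R D).
Local Notation absE := (@absE R D).
Local Notation q := (resq D).
Local Notation aF := (absF_nonarch D).
Local Notation aE := (absE_abs D).
Local Notation BF := (borel (field_dist absF)).
Local Notation BE := (borel (field_dist absE)).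
Local Notation BM := (borel (@mx_dist R E absE 3 3)).
Local Notation Fstar := ([set r : F | r != 0] : set BF).
Local Notation Estar := ([set a : E | a != 0] : set BE).

Variables (muF : {measure set BF -> \bar R}) (muE : {measure set BE -> \bar R}).
Variables (n : nat) (muK : {measure set BM -> \bar R}).
Hypotheses (muFP : haar_units muF) (muKP : haar_compact (@K_H R D n) muK).

Let mFstar : measurable Fstar := measurable_nonzero aF.
Let mEstar : measurable Estar := measurable_nonzero aE.
Let mK : measurable (K_H n : set BM) := @measurable_K_H R D n.

Local Notation I s := (cintegral muF Fstar (ball_power s)).

Lemma z_integrand_ball s (h1 : 'M[F]_2) (c r : F) : c != 0 -> r != 0 ->
  Phi_n n (matrix_of_rows 1 2 [:: [:: 0; r]] *m h1) = (absF (c * r) <= 1)%R%:R ->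
  z_integrand s h1 (Phi_n n) r = cpow (absE c%:A)^-1 s * ball_power s (c * r).
Proof.
move=> c0 r0 PhiE; rewrite /z_integrand PhiE /ball_power mulrCA; congr (_ * _).
rewrite -cpowM ?invr_gt0 ?absE_alg_gt0 ?mulf_neq0 //.
have -> : absE (c * r)%:A = absE c%:A * absE r%:A.
  by rewrite !absE_F (nabsM aF) exprMn.
by rewrite mulKf // gt_eqF // absE_alg_gt0.
Qed.

Lemma z_integrand_cintegrable s (h1 : 'M[F]_2) : \det h1 = 1 ->
  cintegrable muF Fstar (ball_power s) ->
  cintegrable muF Fstar (z_integrand s h1 (Phi_n n)).
Proof.
move=> det1 cI; have [c [c0 _ PhiE]] := Phi_n_ball n det1.
apply: (eq_cintegrable mFstar _
  (cintegrableZ mFstar (cpow (absE c%:A)^-1 s) (cintegrable_scale muFP c0 cI))).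
by move=> r r0; rewrite (z_integrand_ball s c0 r0 (PhiE r)).
Qed.

Lemma ball_power_of_z_integrand s :
  cintegrable muF Fstar (z_integrand s 1%:M (Phi_n n)) ->
  cintegrable muF Fstar (ball_power s).
Proof.
have [c [c0 cE PhiE]] := Phi_n_ball n (det1 F 2).
apply: eq_cintegrable => // r r0; rewrite (z_integrand_ball _ c0 r0) //.
have c1 : absF c = 1.
  by rewrite cE !mxE /= (nabs0 aF) mul0r (nabs1 aF) max_r ?ler01.
by rewrite absE_F c1 expr1n invr1 cpow1 mul1r /ball_power !absE_F (nabsM aF) c1 mul1r.
Qed.

(** If [t(a) k] decomposes as [(b, h1)], then [|b| = |c| |a|], where [c] is the
    radius attached to [h1] by [Phi_n_ball]. *)
Lemma f_s_torus_compact s (a : E) k : a != 0 -> K_H n k ->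
  cintegrable muF Fstar (ball_power s) ->
  f_s muF s (t_mx a *m k) (Phi_n n) = cpow (absE a) s * I s.
Proof.
move=> a0 Kk cI; have [[Uk _] [_ [h _ kE]]] := Kk.
have dec : decomposition (t_mx a *m k) !=set0.
  rewrite -kE -cornersM; apply: decomposition_exists; rewrite cornersM kE.
  by apply: U3_mul => //; exact: U3_t_mx.
rewrite /f_s; have := xgetPex (1, 1%:M) dec.
case: (xget _ _) => b h1 dec_bh /=; have [/= b0 det1 _] := dec_bh.
have [c [c0 cE PhiE]] := Phi_n_ball n det1.
have cb : absE c%:A = absE b / absE a.
  by rewrite absE_F cE (decomposition_norm a0 Kk dec_bh).
have a_gt0 : 0 < absE a by rewrite (nabs_gt0 aE).
have c_gt0 := absE_alg_gt0 c0.
have -> : absE b = absE c%:A * absE a by rewrite cb divfK // gt_eqF.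
rewrite cpowM // [_ * cpow (absE a) s]mulrC -mulrA; congr (_ * _).
rewrite /zF (@eq_cintegral _ _ _ _ _ _
  (fun r : BF => cpow (absE c%:A)^-1 s * ball_power s (c * (r : F)))); last first.
  by move=> r r0; exact: z_integrand_ball.
rewrite cintegralZ ?cintegral_scale //; last exact: cintegrable_scale.
by rewrite mulrA [cpow (absE c%:A) s * _]mulrC cpowV // mul1r.
Qed.

Variable W : 'M[E]_3 -> R[i].
Hypothesis W_inv : forall g k, U3 g -> K_H n k -> W (g *m k) = W g.

Lemma Z2_integrandE s (a : E) k : a != 0 -> K_H n k ->
  cintegrable muF Fstar (ball_power s) ->
  Z2_integrand muF s W (Phi_n n) a k = I s * Z1_integrand s W a.
Proof.
move=> a0 Kk cI; rewrite /Z2_integrand /Z1_integrand f_s_torus_compact //.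
rewrite W_inv //; last exact: U3_t_mx.
by rewrite (cpowD (absE a) s (- 1) : cpow (absE a) (s - 1) = _); ring.
Qed.

(** As [t(u)] lies in [K_{n,H}] for a unit [u], [W(t(a))] only depends on
    [|a|]; this makes it measurable. *)
Lemma Z1_integrand_abs s (a a' : E) : absE a = absE a' ->
  Z1_integrand s W a = Z1_integrand s W a'.
Proof.
move=> aa'; rewrite /Z1_integrand aa'; congr (_ * _).
have [a0|a0] := eqVneq a 0.
  by move: aa'; rewrite a0 (nabs0 aE) => /esym/eqP; rewrite (nabs_eq0 aE) => /eqP ->.
have -> : a' = a * (a^-1 * a') by rewrite mulVKf.
rewrite t_mxM W_inv //; first exact: U3_t_mx.
by apply: t_mx_K_H; rewrite (nabsM aE) (nabsV aE) -aa' mulVf // (nabs_eq0 aE).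
Qed.

Lemma ball_integral_neq0 s : cintegrable muF Fstar (ball_power s) -> I s != 0.
Proof.
by move=> /(ball_integral muFP); apply: contra_eq_neq => ->; rewrite mul0r eq_sym oner_neq0.
Qed.

Lemma ball_integral_L s : cintegrable muF Fstar (ball_power s) -> I s = L_E D s.
Proof.
move=> /(ball_integral muFP) Iz; apply: (canRL (mulfK _) Iz).
by apply/eqP => z0; move: Iz; rewrite z0 mulr0 => /esym/eqP; rewrite oner_eq0.
Qed.

Lemma Z2_inner_norm s (a : E) : a != 0 -> cintegrable muF Fstar (ball_power s) ->
  Rintegral muK (K_H n) (fun k => Re `|Z2_integrand muF s W (Phi_n n) a k|) =
  Re `|I s| * Re `|Z1_integrand s W a|.
Proof.
move=> a0 cI; rewrite -Re_normM.
transitivity (Rintegral muK (K_H n) (fun=> Re `|I s * Z1_integrand s W a|)).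
  by apply: eq_Rintegral => k /set_mem Kk; rewrite Z2_integrandE.
by rewrite Rintegral_cst // (proj2 muKP) mulr1.
Qed.

Lemma Z2_converges_ball s : Z2_converges muF muE n muK W (Phi_n n) s ->
  cintegrable muF Fstar (ball_power s).
Proof. by move=> [cz _ _]; apply: ball_power_of_z_integrand; apply: cz; exact: det1. Qed.

Lemma Z1_converges_of_Z2 s :
  Z2_converges muF muE n muK W (Phi_n n) s -> Z1_converges muE W s.
Proof.
move=> cZ2; have cI := Z2_converges_ball cZ2; have [_ _ outer] := cZ2.
have I0 : Re `|I s| != 0 by rewrite Re_norm_eq0 ball_integral_neq0.
have measurable_part (f : R[i] -> R) :
    measurable_fun Estar (fun a : BE => f (Z1_integrand s W a)).
  apply: (measurable_abs_fun aE (f := fun a : E => f (Z1_integrand s W a))) => a a' aa'.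
  by rewrite (Z1_integrand_abs s aa').
apply: cintegrable_le => //.
have := @integrableZl _ _ _ muE _ mEstar (Re `|I s|)^-1 _ outer.
apply: (eq_integrable mEstar) => a /set_mem a0.
by rewrite Z2_inner_norm // -EFinM mulKf.
Qed.

Lemma Z2_converges_of_Z1 s : 0 < Re s ->
  Z1_converges muE W s -> Z2_converges muF muE n muK W (Phi_n n) s.
Proof.
move=> s0 cZ1; have cI := ball_power_cintegrable muFP s0; split.
- by move=> h1 det1; exact: z_integrand_cintegrable.
- move=> a a0; apply: eq_cintegrable (cintegrable_cst mK (I s * Z1_integrand s W a) (proj2 muKP)) => //.
  by move=> k Kk; rewrite Z2_integrandE.
have := @integrableZl _ _ _ muE _ mEstar (Re `|I s|) _ (cintegrable_norm mEstar cZ1).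
apply: (eq_integrable mEstar) => a /set_mem a0.
by rewrite Z2_inner_norm.
Qed.

(** The integrand is constant in [k], and [K_{n,H}] has volume one. *)
Lemma Z2_eq_Z1_L s : Z1_converges muE W s ->
  Z2_converges muF muE n muK W (Phi_n n) s ->
  Z2 muF muE n muK W (Phi_n n) s = Z1 muE W s * L_E D s.
Proof.
move=> cZ1 /Z2_converges_ball cI.
rewrite -(ball_integral_L cI) mulrC -cintegralZ //.
apply: eq_cintegral => a a0.
rewrite -[RHS](cintegral_cst mK _ (proj2 muKP)); apply: eq_cintegral => k Kk.
by rewrite Z2_integrandE.
Qed.

End ZetaIntegrals.

(** * Rational functions of q^(-2s) *)

Section RationalFunctions.
Context (R : realType) (D : unramified_quadratic R).
Local Notation q := (resq D).

(** The real points [s = s0 + 1, s0 + 2, ...] already give infinitely many values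
    of [q^(-2s)]. *)
Lemma poly_eq0_at_qm2s (p : {poly R[i]}) (s0 : R) :
  (forall s, s0 < Re s -> p.[qm2s D s] = 0) -> p = 0.
Proof.
move=> p0; apply/eqP/negPn/negP => pn0.
pose x k := qm2s D (s0 + k.+1%:R)%:C.
have x_inj : injective x.
  move=> k l /(congr1 (fun z => Re `|z|)); rewrite !Re_norm_qm2s /=.
  move=> /expR_inj /oppr_inj /eqP; rewrite -!mulrnAr => /eqP /mulIf.
  have lnq : ln q%:R *+ 2 != 0 :> R by rewrite mulrn_eq0 /= gt_eqF // ln_gt0 // q_gt1.
  by move=> /(_ lnq) /addrI /eqP; rewrite eqr_nat eqSS => /eqP.
pose rs := map x (iota 0 (size p)).
have root_rs : all (root p) rs.
  by apply/allP => _ /mapP[k _ ->]; apply/rootP/p0 => /=; rewrite ltrDl ltr0n.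
have uniq_rs : uniq rs by rewrite map_inj_uniq ?iota_uniq.
by have := max_poly_roots pn0 root_rs uniq_rs; rewrite size_map size_iota ltnn.
Qed.

Lemma defines_rational_uniq cvg (I : R[i] -> R[i]) r r' :
  defines_rational D cvg I r -> defines_rational D cvg I r' -> r = r'.
Proof.
move=> [N [P [P0 -> [s0 IE]]]] [N' [P' [P'0 -> [s0' IE']]]].
apply/eqP; rewrite eqr_div ?tofrac_eq0 // -!tofracM tofrac_eq -subr_eq0; apply/eqP.
apply: (@poly_eq0_at_qm2s _ (Num.max s0 s0')) => s.
rewrite gt_max => /andP[/IE[_ Ps Is] /IE'[_ P's I's]].
apply/eqP; rewrite !hornerE subr_eq0 -eqr_div //.
by rewrite -Is -I's.
Qed.

Lemma rational_ofE cvg (I : R[i] -> R[i]) r :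
  defines_rational D cvg I r -> rational_of D cvg I = r.
Proof.
move=> Ir; apply: (@defines_rational_uniq cvg I) => //.
by apply: xgetPex; exists r.
Qed.

Lemma qm2s_neq1 s : 0 < Re s -> 1 - qm2s D s != 0.
Proof.
move=> s0; have := norm_qm2s_lt1 D s0; rewrite subr_eq0 => lt1.
by apply/eqP => z1; move: lt1; rewrite -z1 normr1 ltxx.
Qed.

(** The two integrals define rational functions together or not at all; in the
    latter case both sides are [0]. *)
Lemma rational_of_mul_L (cvg cvg' : R[i] -> Prop) (I I' : R[i] -> R[i]) :
  (forall s, 0 < Re s -> cvg s <-> cvg' s) ->
  (forall s, cvg s -> cvg' s -> I' s = I s * L_E D s) ->
  rational_of D cvg' I' = rational_of D cvg I * L_E_rat R.
Proof.
move=> cc' I'E.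
have X1 : (1 - 'X : {poly R[i]}) != 0.
  by rewrite -opprB oppr_eq0 polyXsubC_eq0.
have hornerX1 s : (1 - 'X : {poly R[i]}).[qm2s D s] = 1 - qm2s D s by rewrite !hornerE.
have up r : defines_rational D cvg I r -> defines_rational D cvg' I' (r * L_E_rat R).
  move=> [N [P [P0 -> [s0 IE]]]]; exists N, (P * (1 - 'X)); split.
  - by rewrite mulf_neq0.
  - by rewrite /L_E_rat mulf_div mulr1 tofracM.
  exists (Num.max 0 s0) => s; rewrite gt_max => /andP[s_gt0 /IE[cs Ps Is]].
  have c's := proj1 (cc' _ s_gt0) cs; split=> //.
    by rewrite hornerM hornerX1 mulf_neq0 // qm2s_neq1.
  by rewrite I'E // Is hornerM hornerX1 /L_E mulf_div mulr1.
have down r : defines_rational D cvg' I' r ->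
    defines_rational D cvg I (r * tofrac (1 - 'X)).
  move=> [N [P [P0 -> [s0 IE]]]]; exists (N * (1 - 'X)), P; split=> //.
    by rewrite tofracM mulrAC.
  exists (Num.max 0 s0) => s; rewrite gt_max => /andP[s_gt0 /IE[c's Ps I's]].
  have cs := proj2 (cc' _ s_gt0) c's; split=> //.
  rewrite hornerM hornerX1 mulrAC -I's I'E // /L_E.
  by rewrite mul1r mulfVK // qm2s_neq1.
have [[r Ir]|noI] := pselect (exists r, defines_rational D cvg I r).
  by rewrite (rational_ofE Ir) (rational_ofE (up _ Ir)).
rewrite /rational_of !xgetPN ?mul0r // => r Ir; apply: noI; first by exists r.
by exists (r * tofrac (1 - 'X)); exact: down.
Qed.

End RationalFunctions.

(** * The identity of zeta integrals *)

Theorem proposition2p4 (R : realType) (D : unramified_quadratic R)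
  (muF : {measure set (borel (field_dist (@absF R D))) -> \bar R})
  (muE : {measure set (borel (field_dist (@absE R D))) -> \bar R})
  (n : nat)
  (muK : {measure set (borel (@mx_dist R (extE D) (@absE R D) 3 3)) -> \bar R})
  (V : lmodType R[i]) (pi : 'M[extE D]_3 -> {linear V -> V})
  (psi : extE D -> R[i]) (W : 'M[extE D]_3 -> R[i]) :
  haar_units muF ->
  haar_units muE ->
  haar_compact (@K_H R D n) muK ->
  irreducible_representation pi ->
  nontrivial_character psi ->
  generic pi psi ->
  whittaker_model pi psi W ->
  (forall g k, U3 g -> K_H n k -> W (g *m k) = W g) ->
  (* the identity of integrals, wherever they converge absolutely *)
  (forall s : R[i],
     Z1_converges muE W s ->
     Z2_converges muF muE n muK W (Phi_n n) s ->
     Z2 muF muE n muK W (Phi_n n) s = Z1 muE W s * L_E D s) /\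
  (* the identity in C(q^{-2s}) *)
  Z2_rat muF muE n muK W (Phi_n n) = Z1_rat muE W * L_E_rat R.
Proof.
move=> muFP _ muKP _ _ _ _ W_inv; split=> [s|]; first exact: Z2_eq_Z1_L.
apply: rational_of_mul_L => [s s0|s]; last exact: Z2_eq_Z1_L.
by split; [exact: Z2_converges_of_Z1|exact: Z1_converges_of_Z2].
Qed.
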